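(* Let $k$ be an $F$-finite field of characteristic $p>0$, let $R$ be a commutative ring of finite type over $k$, let $\mathcal{C}$ be an $R$-Cartier algebra, and let $M$ be a coherent left $\mathcal{C}$-module. Then the test module $\tau(M,\mathcal{C})$ exists.
   Context: A field $k$ of characteristic $p$ is $F$-finite if $[k:k^p]<\infty$. $R$-Cartier algebra: an $\mathbb{N}$-graded (generally non-commutative) ring $\mathcal{C}=\bigoplus_{e\ge 0}\mathcal{C}_e$ with a ring homomorphism $R\to\mathcal{C}$ whose image is $\mathcal{C}_0$, such that $r\cdot\phi=\phi\cdot r^{p^e}$ for all $r\in R$, $\phi\in\mathcal{C}_e$. Every left $\mathcal{C}$-module $M$ is an $R$-module via $R\to\mathcal{C}_0$; it is coherent if it is finitely generated as an $R$-module. Put $\mathcal{C}_+=\bigoplus_{e\ge1}\mathcal{C}_e$ and let $\mathcal{C}_+^nM$ be the $\mathcal{C}$-submodule of $M$ generated by all $\phi_1\cdots\phi_n m$ with $\phi_i\in\mathcal{C}_+$, $m\in M$. $M$ is $F$-pure if $\mathcal{C}_+M=M$. For coherent $M$ the chain $M\supseteq\mathcal{C}_+M\supseteq\mathcal{C}_+^2M\supseteq\cdots$ stabilizes, and its stable member $\underline{M}_{\mathcal{C}}$ is the largest $F$-pure $\mathcal{C}$-submodule of $M$. Test module: $\tau(M,\mathcal{C})$ is the smallest $\mathcal{C}$-submodule $N\subseteq M$ such that $N_\eta=(\underline{M}_{\mathcal{C}})_\eta$ for each generic point $\eta$ of an irreducible component of $\operatorname{Supp}\underline{M}_{\mathcal{C}}$.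 It ''exists'' if such a smallest submodule exists. *)

(* Defs.v *)
From HB Require Import structures.
From mathcomp Require Import all_boot all_order all_algebra.
From mathcomp Require Import boolp classical_sets.
From mathcomp Require Import topology_structure.
Set Implicit Arguments.
Unset Strict Implicit.
Unset Printing Implicit Defensive.

Import GRing.Theory.
Local Open Scope classical_set_scope.
Local Open Scope ring_scope.

(* [k : k^p] is finite: k is spanned by finitely many elements over its
   subfield k^p, whose elements are the c ^+ p. *)
Definition F_finite (p : nat) (k : fieldType) : Prop :=
  exists n (b : 'I_n -> k), forall x : k, exists c : 'I_n -> k,
    x = \sum_i c i ^+ p * b i.

(* MathComp algebras are non-zero; a structure morphism k -> R also covers the
   zero ring. *)
Definition of_finite_type (k : fieldType) (R : comPzRingType)
    (f : {rmorphism k -> R}) : Prop :=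
  exists n (x : 'I_n -> R),
    smallest (fun A : set R => subring_closed (mem A)) (range f `|` range x)
    = setT.

Record is_graded_ring (C : pzRingType) (Cg : nat -> set C) : Prop :=
  IsGradedRing {
    grading_zmod : forall e, zmod_closed (mem (Cg e)) ;
    grading_one : Cg 0%N 1 ;
    grading_mul : forall d e x y, Cg d x -> Cg e y -> Cg (d + e)%N (x * y) ;
    grading_span : forall x, exists n (c : nat -> C),
      (forall e, Cg e (c e)) /\ x = \sum_(0 <= e < n) c e ;
    grading_direct : forall n (c : nat -> C), (forall e, Cg e (c e)) ->
      \sum_(0 <= e < n) c e = 0 -> forall e, (e < n)%N -> c e = 0
  }.

Record is_cartier_algebra (p : nat) (R : comPzRingType) (C : pzRingType)
    (iota : {rmorphism R -> C}) (Cg : nat -> set C) : Prop :=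
  IsCartierAlgebra {
    cartier_graded : is_graded_ring Cg ;
    cartier_image : range iota = Cg 0%N ;
    cartier_comm : forall e r phi, Cg e phi ->
      iota r * phi = phi * iota (r ^+ (p ^ e))
  }.

Definition irrelevant_part (C : pzRingType) (Cg : nat -> set C) : set C :=
  [set x | exists n (c : nat -> C),
     (forall e, Cg e (c e)) /\ x = \sum_(1 <= e < n) c e].

(* A left C-module M is an R-module through r . m := iota r *: m. *)
Definition coherent (R : comPzRingType) (C : pzRingType)
    (iota : {rmorphism R -> C}) (M : lmodType C) : Prop :=
  exists n (g : 'I_n -> M), forall m : M, exists r : 'I_n -> R,
    m = \sum_i iota (r i) *: g i.

Definition is_submodule (C : pzRingType) (M : lmodType C) (N : set M) : Prop :=
  submod_closed (mem N).

Definition Cplus_power (C : pzRingType) (Cg : nat -> set C) (M : lmodType C)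
    (n : nat) : set M :=
  smallest (@is_submodule C M)
    [set y | exists (phi : 'I_n -> C) (m : M),
       (forall i, irrelevant_part Cg (phi i)) /\ y = (\prod_i phi i) *: m].

Definition is_stable_member (C : pzRingType) (Cg : nat -> set C)
    (M : lmodType C) (N : set M) : Prop :=
  exists n0, forall n, (n0 <= n)%N -> Cplus_power Cg n = N.

(* MathComp's prime ideals are only available over non-zero rings. *)
Record is_prime_ideal (R : comPzRingType) (P : set R) : Prop :=
  IsPrimeIdeal {
    prime_zmod : zmod_closed (mem P) ;
    prime_mull : forall a x, P x -> P (a * x) ;
    prime_proper : ~ P 1 ;
    prime_mul : forall x y, P (x * y) -> P x \/ P y
  }.

Record Spec (R : comPzRingType) : Type := MkSpec {
  spec_ideal :> set R ;
  spec_prime : is_prime_ideal spec_ideal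
}.

HB.instance Definition _ (R : comPzRingType) := gen_eqMixin (Spec R).
HB.instance Definition _ (R : comPzRingType) := gen_choiceMixin (Spec R).

Section Zariski.
Context (R : comPzRingType).

Definition zariski_open (U : set (Spec R)) : Prop :=
  exists E : set R, U = [set P : Spec R | ~ (E `<=` P)].

Lemma zariski_openT : zariski_open setT.
Proof.
exists [set 1]; apply/seteqP; split => // P _ /= H.
exact: (prime_proper (spec_prime P)) (H _ erefl).
Qed.

Lemma zariski_openI : setI_closed zariski_open.
Proof.
move=> _ _ [E ->] [F ->].
exists [set z | exists x y, [/\ E x, F y & z = x * y]].
apply/seteqP; split => P /=.
  move=> [nE nF] H; apply: nE => x Ex; apply: contrapT => nPx.
  apply: nF => y Fy.
  by case: (prime_mul (spec_prime P) (H (x * y) _)) => //; exists x, y.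
by move=> H; split=> S; apply: H => _ [x [y [Ex Fy ->]]];
  [rewrite mulrC|]; apply: (prime_mull (spec_prime P)); apply: S.
Qed.

Lemma zariski_open_bigU (I : Type) (f : I -> set (Spec R)) :
  (forall i, zariski_open (f i)) -> zariski_open (\bigcup_i f i).
Proof.
move=> H; have [E HE] := choice H.
exists (\bigcup_i E i); apply/seteqP; split => P /=.
  by move=> [i _]; rewrite HE /= => nE S; apply: nE => x Ex; apply: S; exists i.
move=> nS; apply: contrapT => nf; apply: nS => x [i _ Ex].
apply: contrapT => nPx; apply: nf; exists i => //.
by rewrite HE /= => S; apply: nPx; apply: S.
Qed.

HB.instance Definition _ := isOpenTopological.Build (Spec R)
  zariski_openT zariski_openI zariski_open_bigU.

End Zariski.

Definition is_irreducible (T : topologicalType) (Z : set T) : Prop :=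
  Z !=set0 /\
  forall A B : set T, closed A -> closed B ->
    Z `<=` A `|` B -> Z `<=` A \/ Z `<=` B.

Definition irreducible_component (T : topologicalType) (X Z : set T) : Prop :=
  [/\ is_irreducible Z, Z `<=` X &
    forall Z', is_irreducible Z' -> Z' `<=` X -> Z `<=` Z' -> Z' = Z].

(* The closure of {x} in the subspace Z is all of Z. *)
Definition is_generic_point (T : topologicalType) (Z : set T) (x : T) : Prop :=
  Z x /\ Z `<=` closure [set x].

Section Localization.
Context (R : comPzRingType) (C : pzRingType) (iota : {rmorphism R -> C}).
Context (M : lmodType C).

(* The fraction m / s in M_eta, as an equivalence class of pairs. *)
Definition fraction (eta : Spec R) (m : M) (s : R) : set (M * R) :=
  [set mt | ~ spec_ideal eta mt.2 /\
     exists u, ~ spec_ideal eta u /\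
       iota u *: (iota mt.2 *: m - iota s *: mt.1) = 0].

(* N_eta, as a subset of M_eta, for an R-submodule N of M. *)
Definition localize (N : set M) (eta : Spec R) : set (set (M * R)) :=
  [set z | exists m s, [/\ N m, ~ spec_ideal eta s & z = fraction eta m s]].

Definition support (N : set M) : set (Spec R) :=
  [set eta | localize N eta <> [set fraction eta 0 1]].

End Localization.

Section TestModule.
Context (R : comPzRingType) (C : pzRingType) (iota : {rmorphism R -> C}).
Context (Cg : nat -> set C) (M : lmodType C).

Definition agrees_generically (Mc N : set M) : Prop :=
  forall (Z : set (Spec R)) (eta : Spec R),
    irreducible_component (support iota Mc) Z -> is_generic_point Z eta ->
    localize iota N eta = localize iota Mc eta.

(* Relational in Mc, so that a chain C_+^n M without stable member has no test
   module, rather than one computed from a default value. *)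
Definition is_test_module (N : set M) : Prop :=
  exists Mc : set M, [/\ is_stable_member Cg Mc,
    is_submodule N /\ agrees_generically Mc N &
    forall N' : set M, is_submodule N' -> agrees_generically Mc N' ->
      N `<=` N'].

End TestModule.

(* Main.v *)
From HB Require Import structures.
Require Import Defs.
From mathcomp Require Import all_boot all_order all_algebra zify.
From mathcomp Require Import boolp classical_sets.
Set Implicit Arguments.
Unset Strict Implicit.
Unset Printing Implicit Defensive.
Import GRing.Theory.
Local Open Scope classical_set_scope.
Local Open Scope ring_scope.

(* Write U for the stable member of the chain C_+^n M, so that C_+ U = U. It is
   enough to find, for every prime eta, a set G with s U <= G for some s outside
   eta that is contained in each C-submodule N with t U <= N for some t outside
   eta: the intersection of all submodules agreeing with U at the generic points
   then contains these G, hence agrees with U as well.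

   Since U is finitely generated, finitely many homogeneous phi_i in C_+ satisfy
   U = sum_i phi_i(U). Filter M by finite-dimensional k-subspaces W_d given by
   bounding the exponents of monomials. As k is F-finite, the phi_i contract this
   gauge: if N is generated over R by its part in W_d, then sum_i phi_i(N) is
   generated by its part in W_(d/2+K). So below each N stable under the phi_i
   with s U <= N there is another such module generated by its part in the fixed
   finite-dimensional W_(2K), and among those a minimal one is the least one. *)

(** * Hilbert's basis theorem *)

Section AdditiveClosure.
Variable V : nmodType.
Implicit Types (S N : set V) (x y v : V).

Inductive gen S : V -> Prop :=
| gen0 : gen S 0
| genD x v : S x -> gen S v -> gen S (x + v).

Lemma mem_gen S x : S x -> gen S x.
Proof. by move=> Sx; rewrite -[x]addr0; apply: genD => //; apply: gen0. Qed.

Lemma gen_add S x y : gen S x -> gen S y -> gen S (x + y).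
Proof.
by move=> gx gy; elim: gx => [|u v Su _ IH]; rewrite ?add0r // -addrA; apply: genD.
Qed.

Definition add_closed N := N 0 /\ forall x y, N x -> N y -> N (x + y).

Lemma gen_closed S : add_closed (gen S).
Proof. by split; [apply: gen0|apply: gen_add]. Qed.

Lemma gen_min S N : add_closed N -> S `<=` N -> gen S `<=` N.
Proof. by case=> N0 ND SN v; elim=> // x w /SN Nx _; apply: ND. Qed.

Lemma gen_mono S S' : S `<=` S' -> gen S `<=` gen S'.
Proof. by move=> SS'; apply: gen_min (gen_closed _) _ => x /SS'; apply: mem_gen. Qed.

End AdditiveClosure.

Definition additive_map (U V : nmodType) (h : U -> V) :=
  h 0 = 0 /\ forall x y, h (x + y) = h x + h y.

(** Serves as the induction principle for all spans below: with [h] a multiplication or an operator,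
    only single terms remain to be checked. *)
Lemma gen_preim (U V : nmodType) (h : U -> V) (S : set U) (N : set V) :
  additive_map h -> add_closed N -> (forall x, S x -> N (h x)) ->
  forall x, gen S x -> N (h x).
Proof.
move=> [h0 hD] [N0 ND] SN; apply: gen_min => //; split=> [|x y Nx Ny].
  by rewrite h0.
by rewrite hD; apply: ND.
Qed.

Definition is_subring (R : comPzRingType) (B : set R) :=
  [/\ B 1, forall a b, B a -> B b -> B (a - b) & forall a b, B a -> B b -> B (a * b)].

Section Subring.
Variables (R : comPzRingType) (B : set R).
Hypothesis Bring : is_subring B.

Lemma subring0 : B 0.
Proof. by case: Bring => B1 BB _; rewrite -(subrr 1); apply: BB. Qed.

Lemma subringN a : B a -> B (- a).
Proof. by case: Bring => _ BB _ Ba; rewrite -sub0r; apply: BB => //; apply: subring0. Qed.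

Lemma subringD a b : B a -> B b -> B (a + b).
Proof.
by case: Bring => _ BB _ Ba Bb; rewrite -(opprK b); apply: BB => //; apply: subringN.
Qed.

Lemma subringX a i : B a -> B (a ^+ i).
Proof.
by case: Bring => B1 _ BM Ba; elim: i => [|i IH]; rewrite ?expr0 // exprS; apply: BM.
Qed.
End Subring.

Lemma subring_setT (R : comPzRingType) : is_subring [set: R].
Proof. by []. Qed.

Section Submodules.
Variables (R : comPzRingType) (V : lmodType R).
Implicit Types (B : set R) (S N X : set V) (s : seq V).

(** Scalars form a subset [B] of [R] instead of a type, so that the image of k, the successive rings
    of Hilbert's theorem and all of [R] act on the same [V]. *)
Definition submod B N :=
  add_closed N /\ forall b x, B b -> N x -> N (b *: x).

Definition lspan B S : set V :=
  gen [set y | exists b g, [/\ B b, S g & y = b *: g]].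

Definition lspan_seq B s := lspan B [set g | g \in s].

Definition fin_gen B N := exists s, [set g | g \in s] `<=` N /\ N `<=` lspan_seq B s.

Lemma lspan_submod B S : is_subring B -> submod B (lspan B S).
Proof.
case=> _ _ BM; split; first exact: gen_closed.
move=> b x Bb; apply: (gen_preim (h := fun x => b *: x)).
- by split; [rewrite scaler0|move=> *; rewrite scalerDr].
- exact: gen_closed.
move=> _ [c [g [Bc Sg ->]]]; apply: mem_gen; exists (b * c), g.
by rewrite scalerA; split=> //; apply: BM.
Qed.

Lemma lspan_sub B S : is_subring B -> S `<=` lspan B S.
Proof. by case=> B1 _ _ x Sx; apply: mem_gen; exists 1, x; rewrite scale1r. Qed.

Lemma lspan_min B S N : submod B N -> S `<=` N -> lspan B S `<=` N.
Proof.
move=> [Nadd NZ] SN; apply: gen_min => // _ [b [g [Bb /SN Ng ->]]]; exact: NZ.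
Qed.

Lemma lspan_mono B S S' : S `<=` S' -> lspan B S `<=` lspan B S'.
Proof.
move=> SS'; apply: gen_mono => _ [b [g [Bb /SS' Sg ->]]]; by exists b, g.
Qed.

Lemma submodN B N x : is_subring B -> submod B N -> N x -> N (- x).
Proof.
move=> Br [_ NZ] Nx; rewrite -scaleN1r; apply: NZ => //; apply: (subringN Br).
by case: Br.
Qed.

Lemma submodB B N x y : is_subring B -> submod B N -> N x -> N y -> N (x - y).
Proof. by move=> Br Ns Nx Ny; case: (Ns) => -[_ ND] _; apply/ND/(submodN Br). Qed.

Lemma submodI B N N' : submod B N -> submod B N' -> submod B (N `&` N').
Proof.
move=> [[N0 ND] NZ] [[N'0 N'D] N'Z]; split; first split=> //.
  by move=> x y [? ?] [? ?]; split; [apply: ND|apply: N'D].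
by move=> b x Bb [? ?]; split; [apply: NZ|apply: N'Z].
Qed.

Definition sumset N N' : set V :=
  [set z | exists x y, [/\ N x, N' y & z = x + y]].

Lemma submod_sumset B N N' : submod B N -> submod B N' -> submod B (sumset N N').
Proof.
move=> [[N0 ND] NZ] [[N'0 N'D] N'Z]; split; first split.
- by exists 0, 0; rewrite addr0.
- move=> _ _ [x [y [Nx Ny ->]]] [x' [y' [Nx' Ny' ->]]].
  by exists (x + x'), (y + y'); rewrite addrACA; split; [apply: ND|apply: N'D|].
move=> b _ Bb [x [y [Nx Ny ->]]].
by exists (b *: x), (b *: y); rewrite scalerDr; split; [apply: NZ|apply: N'Z|].
Qed.

Lemma lspan_seq_nil B : lspan_seq B [::] `<=` [set 0].
Proof. by apply: gen_min => [|_ [b [g [_]]]] //; split=> // x y -> ->; rewrite addr0. Qed.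

Lemma lspan_seq_cons B g s : is_subring B -> lspan_seq B (g :: s) `<=`
  [set v | exists b w, [/\ B b, lspan_seq B s w & v = b *: g + w]].
Proof.
move=> Br; have [[s0 sD] sZ] := lspan_submod [set h | h \in s] Br.
apply: gen_min; first split.
- by exists 0, 0; rewrite scale0r addr0; split=> //; apply: (subring0 Br).
- move=> _ _ [b [w [Bb sw ->]]] [c [u [Bc su ->]]].
  exists (b + c), (w + u); rewrite scalerDl addrACA; split=> //; last exact: sD.
  exact: (subringD Br).
move=> _ [b [h [Bb /= + ->]]]; rewrite inE => /predU1P[->|hs].
  by exists b, 0; rewrite addr0; split.
exists 0, (b *: h); rewrite scale0r add0r; split=> //; first exact: (subring0 Br).
by apply: sZ => //; apply: (lspan_sub Br).
Qed.

End Submodules.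

(* A submodule N of Bg + X is generated by lifts of generators of the ideal of
   leading coefficients of N, together with generators of N /\ X. *)
Lemma lift_leading (R : comPzRingType) (V : lmodType R) (B : set R) (g : V)
    (X N : set V) (bs : seq R^o) : is_subring B -> submod B X -> submod B N ->
  (forall b, b \in bs -> exists w, X w /\ N (b *: g + w)) ->
  exists hs, [set h | h \in hs] `<=` N /\
    forall c, @lspan R R^o B [set b | b \in bs] c ->
      exists h w, [/\ lspan_seq B hs h, X w & h = c *: g + w].
Proof.
move=> Br Xs Ns; elim: bs => [|b bs IH] Hbs.
  exists [::]; split=> // c /(@lspan_seq_nil R R^o) -> ; exists 0, 0.
  by rewrite scale0r addr0; split=> //; [apply: gen0|case: Xs => -[]].
have [w [Xw Nw]] := Hbs b (mem_head _ _).
have [c cbs|hs [hsN Hhs]] := IH; first by apply: Hbs; rewrite inE cbs orbT.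
exists (b *: g + w :: hs); split=> [h /=|].
  by rewrite inE => /predU1P[->|/hsN].
move=> _ /(lspan_seq_cons Br) [a [c [Ba /Hhs [h [u [hsh Xu eh]]] ->]]].
exists (a *: (b *: g + w) + h), (a *: w + u).
have [[_ sD] sZ] := lspan_submod [set k | k \in b *: g + w :: hs] Br.
split.
- apply: sD; first by apply: sZ => //; apply: (lspan_sub Br); apply: mem_head.
  by apply: lspan_mono hsh => k /=; rewrite inE orbC => ->.
- by case: Xs => -[_ XD] XZ; apply: XD => //; apply: XZ.
by rewrite eh scalerDr scalerA [a *: b]/(_ * _) scalerDl addrACA.
Qed.

Lemma scale_regular (R : comPzRingType) (a b : R) : a *: (b : R^o) = a * b :> R.
Proof. by []. Qed.

Definition noeth (R : comPzRingType) (B : set R) :=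
  forall I : set R^o, submod B I -> I `<=` B -> fin_gen B I.

(** * Noetherian modules and adjunction of one element *)

Section Noetherian.
Variables (R : comPzRingType) (B : set R).
Hypotheses (Br : is_subring B) (Bn : noeth B).

Lemma leading_fin_gen (V : lmodType R) (g : V) (X N : set V) :
  submod B X -> submod B N ->
  fin_gen B ([set b | B b /\ exists w, X w /\ N (b *: g + w)] : set R^o).
Proof.
move=> [[X0 XD] XZ] [[N0 ND] NZ]; apply: Bn => [|b []//].
split; first split.
- split; first exact: (subring0 Br).
  by exists 0; rewrite scale0r addr0.
- move=> b c [Bb [w [Xw Nw]]] [Bc [u [Xu Nu]]]; split; first exact: (subringD Br).
  exists (w + u); split; first exact: XD.
  by rewrite scalerDl addrACA; apply: ND.
move=> a b Ba [Bb [w [Xw Nw]]]; split; first by case: Br => _ _; apply.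
exists (a *: w); split; first exact: XZ.
by rewrite [a *: b]/(_ * _) -scalerA -scalerDr; apply: NZ.
Qed.

Lemma noeth_module (V : lmodType R) (gs : seq V) (N : set V) :
  submod B N -> N `<=` lspan_seq B gs -> fin_gen B N.
Proof.
elim: gs N => [|g gs IH] N Ns sN.
  exists [::]; split=> // x /sN/lspan_seq_nil ->; exact: gen0.
have Xs : submod B (lspan_seq B gs) by apply: lspan_submod.
have [bs [bsJ Jbs]] := leading_fin_gen g Xs Ns.
have [b /bsJ[]//|hs [hsN Hhs]] := lift_leading Br Xs Ns (bs := bs) (g := g).
have [ks [ksN Nks]] := IH _ (submodI Ns Xs) (@subIsetr _ _ _).
exists (hs ++ ks); split=> [x /=|v Nv].
  by rewrite mem_cat => /orP[/hsN|/ksN[]].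
have [c [w [Bc Xw ev]]] := lspan_seq_cons Br (sN _ Nv).
have [|h [u [hsh Xu eh]]] := Hhs c.
  by apply: Jbs; split=> //; exists w; rewrite -ev.
have sub1 : lspan_seq B hs `<=` lspan_seq B (hs ++ ks).
  by apply: lspan_mono => x /= xs; rewrite mem_cat xs.
have sub2 : lspan_seq B ks `<=` lspan_seq B (hs ++ ks).
  by apply: lspan_mono => x /= xs; rewrite mem_cat xs orbT.
(* [h] has the same coefficient on [g] as [v], so [v - h] lies in [N] and in the span of [gs]. *)
rewrite -(subrK h v); apply: gen_add; last exact: sub1.
apply/sub2/Nks; split.
  by apply: (submodB Br) => //; apply: lspan_min hsh.
by rewrite ev eh opprD addrACA subrr add0r; apply: (submodB Br).
Qed.

Definition adjoin (x : R) : set R := gen [set y | exists b i, B b /\ y = b * x ^+ i].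

Lemma adjoin_sub x : B `<=` adjoin x.
Proof. by move=> b Bb; apply: mem_gen; exists b, 0%N; rewrite expr0 mulr1. Qed.

Lemma adjoin_mem x : adjoin x x.
Proof. by apply: mem_gen; exists 1, 1%N; rewrite expr1 mul1r; case: Br. Qed.

Lemma adjoin_subring x : is_subring (adjoin x).
Proof.
have M a b : adjoin x a -> adjoin x b -> adjoin x (a * b).
  move=> Aa; apply: (gen_preim (h := fun b => a * b)).
  - by split; [rewrite mulr0|move=> *; rewrite mulrDr].
  - exact: gen_closed.
  move=> _ [c [i [Bc ->]]].
  apply: (gen_preim (h := fun a => a * (c * x ^+ i))) Aa.
  - by split; [rewrite mul0r|move=> *; rewrite mulrDl].
  - exact: gen_closed.
  move=> _ [d [j [Bd ->]]]; apply: mem_gen; exists (d * c), (j + i)%N.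
  by rewrite mulrACA exprD; split=> //; case: Br => _ _; apply.
split=> //; first by apply: adjoin_sub; case: Br.
move=> a b Aa Ab; apply: gen_add => //; rewrite -mulN1r; apply: M => //.
by apply/adjoin_sub/(subringN Br); case: Br.
Qed.

Let lowdeg x d : set R^o := lspan_seq B [seq (x ^+ i : R^o) | i <- iota 0 d].

Lemma lowdegS x d (v : R^o) : lowdeg x d.+1 v ->
  exists c w, [/\ B c, lowdeg x d w & v = c * x ^+ d + w].
Proof.
rewrite /lowdeg -addn1 iotaD add0n map_cat /= => H.
have [|c [w [Bc lw ->]]] := @lspan_seq_cons _ R^o B (x ^+ d)
    [seq (x ^+ i : R^o) | i <- iota 0 d] Br v.
  apply: lspan_mono H => y /=; rewrite mem_cat !inE => /orP[->|->]//.
  by rewrite orbT.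
by exists c, w.
Qed.

Lemma lowdeg_mul x d m (v : R^o) : lowdeg x d v -> lowdeg x (m + d) (x ^+ m * v).
Proof.
apply: (gen_preim (h := fun v : R^o => x ^+ m * v : R^o)).
- by split; [rewrite mulr0|move=> *; rewrite mulrDr].
- exact: gen_closed.
move=> _ [b [_ [Bb /mapP[i] + -> ->]]]; rewrite mem_iota add0n => /= id.
apply: mem_gen; exists b, (x ^+ (m + i)); split=> //.
  by apply/mapP; exists (m + i)%N => //; rewrite mem_iota add0n ltn_add2l.
by rewrite exprD [b *: _]/(_ * _) [_ *: _]/(_ * _) mulrCA.
Qed.

Lemma adjoin_lowdeg x v : adjoin x v -> exists d, lowdeg x d v.
Proof.
have mon d d' : (d <= d')%N -> lowdeg x d `<=` lowdeg x d'.
  move=> le; apply: lspan_mono => y /= /mapP[i + ->]; rewrite mem_iota add0n => /= id.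
  by apply/mapP; exists i => //; rewrite mem_iota add0n (leq_trans id).
move: v; suff : adjoin x `<=` [set v | exists d, lowdeg x d v] by exact.
apply: gen_min; first split.
- by exists 0%N; apply: gen0.
- move=> u v [d du] [d' dv]; exists (maxn d d'); apply: gen_add.
    exact: mon (leq_maxl _ _) _ du.
  exact: mon (leq_maxr _ _) _ dv.
move=> _ [b [i [Bb ->]]]; exists i.+1; apply: mem_gen; exists b, (x ^+ i); split=> //.
by apply/mapP; exists i => //; rewrite mem_iota /= add0n.
Qed.

(** Powers of [x] may satisfy relations, so a leading coefficient belongs to a representation and
    not to an element. [L d] collects the coefficients of all representations of degree [d] of
    elements of [I]. Multiplication by [x] makes these ideals ascend, and finitely many generators
    of their union occur in a single [L d0]. *)
Theorem hilbert_basis x : noeth (adjoin x).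
Proof.
move=> I Is IA; have Ar := adjoin_subring x.
have IsB : submod B I.
  by case: Is => ? IZ; split=> // b y Bb; apply: IZ; apply: adjoin_sub.
have lows d : submod B (lowdeg x d) by apply: lspan_submod.
pose L d : set R^o := [set b | B b /\ exists w, lowdeg x d w /\ I (b * x ^+ d + w)].
have LS m d : L d `<=` L (m + d)%N.
  move=> b [Bb [w [lw Iw]]]; split=> //; exists (x ^+ m * w).
  split; first exact: lowdeg_mul.
  have -> : b * x ^+ (m + d) + x ^+ m * w = x ^+ m *: (b * x ^+ d + w : R^o).
    by rewrite scale_regular mulrDr mulrCA exprD.
  by case: Is => _ IZ; apply: IZ => //; apply: (subringX Ar); apply: adjoin_mem.
have Ls d : submod B (L d).
  have [[l0 lD] lZ] := lows d; case: IsB => -[I0 ID] IZ; split; first split.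
  - by split; [apply: (subring0 Br)|exists 0; rewrite mul0r addr0].
  - move=> b c [Bb [w [Xw Nw]]] [Bc [u [Xu Nu]]]; split; first exact: (subringD Br).
    exists (w + u); split; first exact: lD.
    by rewrite mulrDl addrACA; apply: ID.
  move=> a b Ba [Bb [w [Xw Nw]]]; split; first by case: Br => _ _; apply.
  exists (a *: w); split; first exact: lZ.
  by rewrite [a *: b]/(_ * _) [a *: w]/(_ * _) -mulrA -mulrDr; apply: IZ.
have [||bs [bsL Lbs]] := Bn (I := \bigcup_d L d).
- split; first split.
  + by exists 0%N => //; case: (Ls 0%N) => -[].
  + move=> b c [d _ Lb] [e _ Lc]; exists (d + e)%N => //.
    by case: (Ls (d + e)%N) => -[_ LD] _; apply: LD; [rewrite addnC|]; apply: LS.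
  by move=> a b Ba [d _ Lb]; exists d => //; case: (Ls d) => _; apply.
- by move=> b [d _ []].
have [d0 bsL0] : exists d0, forall b, b \in bs -> L d0 b.
  elim: bs bsL {Lbs} => [|b bs IH] bsL; first by exists 0%N.
  have [c cbs|d Hd] := IH; first by apply: bsL; rewrite /= inE cbs orbT.
  have [e _ Le] := bsL _ (mem_head _ _); exists (d + e)%N => c.
  rewrite inE => /predU1P[->|/Hd]; first exact: LS.
  by rewrite addnC; apply: LS.
have [b /bsL0[_ //]|hs [hsI Hhs]] :=
  @lift_leading _ R^o B (x ^+ d0) _ I bs Br (lows d0) IsB.
(* In degrees below [d0], [I] is a [B]-submodule of a finitely generated [B]-module. *)
have [ks [ksI Iks]] := noeth_module (submodI IsB (lows d0)) (@subIsetr _ _ _).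
exists (hs ++ ks); split=> [y /=|].
  by rewrite mem_cat => /orP[/hsI|/ksI[]].
have [[A0 AD] AZ] := @lspan_submod _ R^o (adjoin x) [set h | h \in hs ++ ks] Ar.
have BA (s : seq R^o) : {subset s <= hs ++ ks} ->
    lspan_seq B s `<=` lspan_seq (adjoin x) (hs ++ ks).
  move=> ss; apply: gen_mono => _ [b [g [Bb gs ->]]]; exists b, g.
  by split=> //; [apply: adjoin_sub|apply: ss].
have low d v : (d <= d0)%N -> I v -> lowdeg x d v -> lspan_seq (adjoin x) (hs ++ ks) v.
  move=> le Iv lv; apply: (BA ks) => [y|]; first by rewrite mem_cat orbC => ->.
  apply: Iks; split=> //; apply: lspan_mono lv => y /= /mapP[i + ->].
  rewrite mem_iota add0n => /= id; apply/mapP; exists i => //.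
  by rewrite mem_iota add0n (leq_trans id).
move=> v Iv; have [d] := adjoin_lowdeg (IA _ Iv).
elim: d v Iv => [|d IH] v Iv lv; first exact: low lv.
have [le|] := leqP d.+1 d0; [exact: low lv|rewrite ltnS => le].
have [c [w [Bc lw ev]]] := lowdegS lv.
have [|h [u [hsh lu eh]]] := Hhs c.
  by apply: Lbs; exists d => //; split=> //; exists w; rewrite -ev.
have Xm : adjoin x (x ^+ (d - d0)) by apply: (subringX Ar); apply: adjoin_mem.
have hs' : lspan_seq (adjoin x) (hs ++ ks) h.
  by apply: (BA hs) hsh => y; rewrite mem_cat => ->.
(* Cancelling the coefficient of [x ^+ d] leaves an element of [lowdeg x d], to which induction
   applies. *)
rewrite -(subrK (x ^+ (d - d0) *: h) v); apply: AD; last exact: AZ.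
apply: IH.
  apply: (submodB Ar) => //; case: (Is) => _ IZ; apply: IZ => //.
  by apply: lspan_min hsh.
have -> : v - x ^+ (d - d0) *: h = w - x ^+ (d - d0) * u.
  rewrite ev eh !scale_regular mulrDr mulrCA -exprD.
  by rewrite subnK // opprD addrACA subrr add0r.
apply: (submodB Br (lows d)) => //.
by rewrite -{1}(subnK le); apply: lowdeg_mul.
Qed.

End Noetherian.

Lemma noeth_adjoin_seq (R : comPzRingType) (B : set R) (xs : seq R) :
  is_subring B -> noeth B ->
  exists B', [/\ is_subring B', noeth B', B `<=` B' & [set x | x \in xs] `<=` B'].
Proof.
move=> Br Bn; elim: xs => [|x xs [B' [Br' Bn' BB' xsB']]].
  by exists B; split=> // x /=; rewrite in_nil.
exists (adjoin B' x); split.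
- exact: adjoin_subring.
- exact: hilbert_basis.
- by exact/(subset_trans BB')/adjoin_sub.
move=> y /=; rewrite inE => /predU1P[->|/xsB' By]; first exact: adjoin_mem.
exact: adjoin_sub.
Qed.

Lemma range_subring (k : fieldType) (R : comPzRingType) (f : {rmorphism k -> R}) :
  is_subring (range f).
Proof.
split; first by exists 1 => //; rewrite rmorph1.
  by move=> _ _ [a _ <-] [b _ <-]; exists (a - b) => //; rewrite rmorphB.
by move=> _ _ [a _ <-] [b _ <-]; exists (a * b) => //; rewrite rmorphM.
Qed.

(** If [f c] lies in [I] with [c] non-zero, then [f c] generates the whole image; otherwise [I] is
    zero. Testing [c] instead of [f c] also covers the zero ring. *)
Lemma field_noeth (k : fieldType) (R : comPzRingType) (f : {rmorphism k -> R}) :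
  noeth (range f).
Proof.
move=> I [[I0 ID] IZ] If; have [[c [c0 Ic]]|nI] := pselect (exists c, c != 0 /\ I (f c)).
  exists [:: f c : R^o]; split=> [x|_ /If[d _ <-]]; first by rewrite /= inE => /eqP ->.
  apply: mem_gen; exists (f (d / c)), (f c); split=> //; first exact: mem_head.
  by rewrite scale_regular -rmorphM divfK.
exists [::]; split=> // x Ix; have [c _ ec] := If _ Ix.
suff -> : x = 0 by apply: gen0.
have [c0|c0] := eqVneq c 0; first by rewrite -ec c0 rmorph0.
by case: nI; exists c; rewrite ec.
Qed.

Lemma finite_type_noeth (k : fieldType) (R : comPzRingType) (f : {rmorphism k -> R}) :
  of_finite_type f -> noeth [set: R].
Proof.
move=> [n [x xT]].
have [B [Br Bn fB xB]] := noeth_adjoin_seq (codom x) (range_subring f) (@field_noeth _ _ f).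
suff <- : B = setT by [].
apply/seteqP; split => //; rewrite -xT; apply: smallest_sub.
  case: Br => B1 BB BM; split; first by rewrite inE.
  - by move=> u v; rewrite !inE; apply: BB.
  - by move=> u v; rewrite !inE; apply: BM.
by move=> y [/fB//|[i _ <-]]; apply: xB; apply: codom_f.
Qed.

(** * Stability of the chain of images *)

Section MinimalModulo.
Variables (R : comPzRingType) (V : lmodType R) (B S : set R).
Hypotheses (Br : is_subring B) (S1 : S 1).
Hypothesis SM : forall s t, S s -> S t -> S (s * t).
Hypothesis SB : S `<=` B.
Implicit Types (X Y A N : set V) (F : set (set V)).

Definition sle N N' := forall x, N x -> exists t, S t /\ N' (t *: x).

(* The S-localization of Y / X is artinian: sle compares the S-localizations. *)
Definition sartinian X Y := forall F, F !=set0 ->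
  (forall N, F N -> [/\ submod B N, X `<=` N & N `<=` Y]) ->
  exists N, F N /\ forall N', F N' -> N' `<=` N -> sle N N'.

Lemma sle_sub N N' : N `<=` N' -> sle N N'.
Proof. by move=> NN' x Nx; exists 1; rewrite scale1r; split=> //; apply: NN'. Qed.

Lemma sartinian_sle X Y : sle Y X -> sartinian X Y.
Proof.
move=> YX F [N FN] HF; exists N; split=> // N' FN' _ x Nx.
have [_ _ NY] := HF _ FN; have [_ XN' _] := HF _ FN'.
by have [t [St Xt]] := YX _ (NY _ Nx); exists t; split=> //; apply: XN'.
Qed.

(** Minimize the intersection with [A] first, and then, among the members inside the minimizer
    found, the sum with [A]. *)
Lemma sartinian_ext X A Y : submod B A -> submod B Y ->
  X `<=` A -> A `<=` Y -> sartinian X A -> sartinian A Y -> sartinian X Y.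
Proof.
move=> As Ys XA AY artXA artAY F F0 HF.
have [_ [[N1 FN1 <-] min1]] : exists N, [set N `&` A | N in F] N /\
    forall N', [set N `&` A | N in F] N' -> N' `<=` N -> sle N N'.
  apply: artXA; first by case: F0 => N FN; exists (N `&` A); exists N.
  move=> _ [N /HF[Ns XN NY] <-]; split; first exact: submodI.
    by move=> x Xx; split; [apply: XN|apply: XA].
  exact: subIsetr.
pose F1 : set (set V) := [set N | F N /\ N `<=` N1].
have [_ [[N2 [FN2 N21] <-] min2]] : exists N, [set sumset N A | N in F1] N /\
    forall N', [set sumset N A | N in F1] N' -> N' `<=` N -> sle N N'.
  apply: artAY; first by exists (sumset N1 A); exists N1 => //; split.
  move=> _ [N [/HF[Ns XN NY] _] <-]; split; first exact: submod_sumset.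
    by move=> x Ax; exists 0, x; rewrite add0r; case: Ns => -[].
  move=> _ [x [y [/NY Yx /AY Yy ->]]]; by case: Ys => -[_ YD] _; apply: YD.
exists N2; split=> // N' FN' N'2 x N2x.
have [N2s _ _] := HF _ FN2; have [N's _ _] := HF _ FN'.
have [|||t [St [n [a [N'n Aa etx]]]]] := min2 (sumset N' A) _ _ x.
- by exists N' => //; split=> //; exact: (subset_trans N'2 N21).
- move=> _ [u [v [/N'2 N2u Av ->]]]; by exists u, v.
- by exists x, 0; rewrite addr0; split=> //; case: As => -[].
(* Modular law: the error term [a] lies in the intersection of [N2] and [A], where minimality of
   [N1] applies. *)
have N2a : N2 a.
  have -> : a = t *: x - n by rewrite etx addrC addKr.
  apply: (submodB Br) => //; last exact: N'2.
  by case: N2s => _; apply=> //; apply: SB.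
have [|||u [Su [N'u _]]] := min1 (N' `&` A) _ _ a.
- by exists N'.
- by move=> y [/N'2/N21 N1y Ay].
- by split=> //; apply: N21.
exists (u * t); split; first exact: SM.
rewrite -scalerA etx scalerDr.
by case: N's => -[_ N'D] N'Z; apply: N'D => //; apply: N'Z => //; apply: SB.
Qed.

(** After localization each scalar acts on the class of [g] as a unit or as zero, so Y / A becomes
    simple or zero: a member not locally inside [A] contains some [b *: g] with [b] in [S], and this
    [b] multiplies [Y] into it. *)
Lemma sartinian_cyclic A Y g : submod B A ->
  (forall y, Y y -> exists b a, [/\ B b, A a & y = b *: g + a]) ->
  (forall b, B b -> S b \/ exists t, S t /\ A (t *: (b *: g))) ->
  sartinian A Y.
Proof.
move=> As YA Sg F [N0 FN0] HF.
have [[N [FN NA]]|nF] := pselect (exists N, F N /\ sle N A).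
  exists N; split=> // N' FN' _ x /NA[t [St At]]; exists t; split=> //.
  by have [_ AN' _] := HF _ FN'; apply: AN'.
exists N0; split=> // N FN _ x N0x.
have [Ns AN _] := HF _ FN; have [_ _ N0Y] := HF _ FN0.
have [y [Ny nAy]] : exists y, N y /\ forall t, S t -> ~ A (t *: y).
  apply: contrapT => H; apply: nF; exists N; split=> // y Ny.
  apply: contrapT => H'; apply: H; exists y; split=> // t St At.
  by apply: H'; exists t.
case: (As) => -[A0 AD] AZ; case: (Ns) => -[_ ND] NZ.
have [_ _ NY] := HF _ FN.
have [b [a [Bb Aa ey]]] := YA _ (NY _ Ny).
have [Sb|[t [St At]]] := Sg b Bb; last first.
  case: (nAy _ St); rewrite ey scalerDr; apply: AD => //.
  by apply: AZ => //; apply: SB.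
have Nbg : N (b *: g).
  have -> : b *: g = y - a by rewrite ey addrK.
  by apply: (submodB Br) => //; apply: AN.
have [c [a' [Bc Aa' ->]]] := YA _ (N0Y _ N0x).
exists b; split=> //; rewrite scalerDr scalerA mulrC -scalerA.
by apply: ND; [apply: NZ|apply/AN/AZ].
Qed.

End MinimalModulo.

(** * Maximal submodules and artinian localizations *)

Section MaximalSubmodule.
Variables (R : comPzRingType) (Rn : noeth [set: R]).

Lemma noeth_maximal (V : lmodType R) (gs : seq V) (F : set (set V)) :
  lspan_seq setT gs = setT -> F !=set0 -> (forall N, F N -> submod setT N) ->
  exists N, F N /\ forall N', F N' -> N `<=` N' -> N' `<=` N.
Proof.
move=> Vgs [N0 FN0] HF.
(* The empty set is adjoined to [F] to bound the empty chain; it is not maximal, because [N0]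
   contains it properly. *)
have [C CF totC|A [[AE|FA] Amax]] := @Zorn_bigcup V [set N | N = set0 \/ F N].
- have [[M CM [m Mm]]|nC] := pselect (exists2 M, C M & M !=set0); last first.
    left; apply/seteqP; split=> // x [M CM Mx]; case: nC; exists M => //; by exists x.
  right; set U := \bigcup_(X in C) X.
  have Cs X x : C X -> X x -> submod setT X.
    by move=> CX Xx; case: (CF X CX) => [E|/HF//]; rewrite E in Xx.
  have Us : submod setT U.
    have [[M0 _] _] := Cs _ _ CM Mm; split; first split.
    + by exists M.
    + move=> x y [X CX Xx] [Y CY Yy].
      have [[_ XD] _] := Cs _ _ CX Xx; have [[_ YD] _] := Cs _ _ CY Yy.
      have [XY|YX] := totC _ _ CX CY.
        by exists Y => //; apply: YD => //; apply: XY.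
      by exists X => //; apply: XD => //; apply: YX.
    by move=> b x _ [X CX Xx]; exists X => //; have [_] := Cs _ _ CX Xx; apply.
  have [|s [sU Us']] := noeth_module (subring_setT R) Rn (gs := gs) Us.
    by rewrite Vgs.
  (* Finitely many generators of the union of a chain already lie in one member. *)
  suff [X CX sX] : exists2 X, C X & [set g | g \in s] `<=` X /\ X !=set0.
    have Xs : submod setT X by case: sX => _ [x Xx]; apply: Cs Xx.
    have -> : U = X.
      apply/seteqP; split; last exact: bigcup_sup.
      by apply: (subset_trans Us'); apply: lspan_min => //; case: sX.
    by case: (CF _ CX) => // E; case: sX => _ [x]; rewrite E.
  elim: s sU {Us'} => [|g s IH] sU; first by exists M => //; split=> //; exists m.
  have [x /= xs|X CX [sX [x Xx]]] := IH; first by apply: sU; rewrite /= inE xs orbT.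
  have [Y CY Yg] := sU g (mem_head _ _).
  have [XY|YX] := totC _ _ CX CY.
    exists Y => //; split; last by exists g.
    by move=> h /=; rewrite inE => /predU1P[->//|/sX/XY].
  exists X => //; split; last by exists x.
  by move=> h /=; rewrite inE => /predU1P[->|/sX//]; apply: YX.
- case: (Amax N0); last by right.
  rewrite AE; split=> // H; have [[N00 _] _] := HF _ FN0; exact: H N00.
exists A; split=> // N' FN' AN'; apply: contrapT => nN'.
by apply: (Amax N' _ (or_intror FN')).
Qed.

End MaximalSubmodule.

Lemma regular_span (R : comPzRingType) : @lspan_seq R R^o setT [:: 1] = setT.
Proof.
apply/seteqP; split=> // r _; apply: mem_gen; exists r, 1; split=> //=.
  by rewrite inE.
by rewrite scale_regular mulr1.
Qed.

(** The product of the denominators found for the generators is a common denominator. *)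
Lemma sle_fin_gen (R : comPzRingType) (V : lmodType R) (S : set R) (N N' : set V) :
  S 1 -> (forall s t, S s -> S t -> S (s * t)) -> submod setT N' ->
  fin_gen setT N -> sle S N N' -> exists t, S t /\ forall x, N x -> N' (t *: x).
Proof.
move=> S1 SM [[N'0 N'D] N'Z] [gs [gsN Ngs]] NN'.
suff [t [St Ht]] : exists t, S t /\ forall g, g \in gs -> N' (t *: g).
  exists t; split=> // x /Ngs; apply: (gen_preim (h := fun x => t *: x)) => //.
    by split; [rewrite scaler0|move=> *; rewrite scalerDr].
  move=> _ [b [g [_ /Ht N'g ->]]]; rewrite scalerA mulrC -scalerA; exact: N'Z.
elim: gs gsN {Ngs} => [|g gs IH] gsN; first by exists 1.
have [h hgs|t [St Ht]] := IH; first by apply: gsN; rewrite /= inE hgs orbT.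
have [u [Su N'u]] := NN' _ (gsN _ (mem_head _ _)).
exists (t * u); split; first exact: SM.
move=> h; rewrite inE => /predU1P[->|/Ht N'h]; first by rewrite -scalerA; apply: N'Z.
by rewrite mulrC -scalerA; apply: N'Z.
Qed.

Section Artinian.
Variables (R : comPzRingType) (Rn : noeth [set: R]) (S : set R).
Hypotheses (S1 : S 1) (SM : forall s t, S s -> S t -> S (s * t)).

(** Locally, every scalar outside [S] is nilpotent on Y / X, which therefore has finite length. Take
    [A] maximal with A / X artinian. Unless Y / A vanishes locally, some [u] has a maximal
    annihilator modulo [A]; all scalars outside [S] then kill [u], and adjoining [u] to [A] adds a
    simple piece. *)
Lemma sartinian_noeth (V : lmodType R) (gs : seq V) (X Y : set V) :
  lspan_seq setT gs = setT -> submod setT X -> submod setT Y -> X `<=` Y ->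
  (forall r, S r \/ exists s i, S s /\ forall y, Y y -> X (s *: (r ^+ i *: y))) ->
  sartinian setT S X Y.
Proof.
move=> Vgs Xs Ys XY SXY; have Rr := subring_setT R.
have [|N [] //|A [[As XA AY artA] Amax]] := noeth_maximal Rn
    (F := [set A | [/\ submod setT A, X `<=` A, A `<=` Y & sartinian setT S X A]]) Vgs.
  by exists X; split=> //; apply: sartinian_sle => //; apply: sle_sub.
apply: (sartinian_ext Rr SM _ As Ys XA AY) => //; apply: sartinian_sle.
apply: contrapT => nYA.
have [u [Yu nAu]] : exists u, Y u /\ forall t, S t -> ~ A (t *: u).
  apply: contrapT => H; apply: nYA => y Yy.
  apply: contrapT => H'; apply: H; exists y; split=> // t St At.
  by apply: H'; exists t.
case: (As) => -[A0 AD] AZ; case: (Ys) => -[_ YD] YZ.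
pose ann u : set R^o := [set r | exists t, S t /\ A (t *: (r *: u))].
pose F := [set ann u | u in [set u | Y u /\ forall t, S t -> ~ A (t *: u)]].
have [||_ [[{Yu nAu} {}u [Yu nAu] <-] annmax]] :=
  noeth_maximal Rn (F := F) (regular_span R).
- by exists (ann u); exists u.
- move=> _ [v _ <-]; split; first split.
  + by exists 1; rewrite scale0r scaler0.
  + move=> r r' [t [St At]] [t' [St' At']]; exists (t * t'); split; first exact: SM.
    rewrite scalerDl scalerDr; apply: AD; last by rewrite -scalerA; apply: AZ.
    by rewrite mulrC -scalerA; apply: AZ.
  move=> b r _ [t [St At]]; exists t; split=> //.
  by rewrite scale_regular -scalerA scalerA mulrC -scalerA; apply: AZ.
have annP r : S r \/ ann u r.
  have [|[s [i [Ss Hs]]]] := SXY r; first by left.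
  right; apply: contrapT => nr.
  have exi : exists i, `[< ann u (r ^+ i) >].
    by exists i; apply/asboolP; exists s; split=> //; apply/XA/Hs.
  case: (ex_minnP exi) => -[|j] /asboolP annj minj.
    by case: annj => t [St]; rewrite expr0 scale1r => /(nAu _ St).
  have nj : ~ ann u (r ^+ j) by move/asboolP/minj; rewrite ltnn.
  (* With [j.+1] the least exponent whose power of [r] kills [u], the annihilator of [r ^+ j *: u]
     contains that of [u]. By maximality they agree, and the former contains [r]. *)
  apply: nr; apply: (annmax (ann (r ^+ j *: u))).
  - exists (r ^+ j *: u) => //; split; first exact: YZ.
    by move=> t St At; apply: nj; exists t.
  - move=> b [t [St At]]; exists t; split=> //.
    have -> : t *: (b *: (r ^+ j *: u)) = r ^+ j *: (t *: (b *: u)).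
      by rewrite !scalerA; congr (_ *: _); rewrite -[RHS]mulrA mulrC.
    exact: AZ.
  by case: annj => t [St]; rewrite exprS -scalerA => At; exists t.
have us : submod setT (lspan setT [set u]) by apply: lspan_submod.
have uA : (sumset A (lspan setT [set u])) u.
  by exists 0, u; rewrite add0r; split=> //; apply: lspan_sub.
suff Au : A u by apply: (nAu 1) => //; rewrite scale1r.
apply: (Amax (sumset A (lspan setT [set u]))) uA.
  have AA' : A `<=` sumset A (lspan setT [set u]).
    by move=> x Ax; exists x, 0; rewrite addr0; split=> //; case: us => -[].
  have A's := submod_sumset As us.
  split=> //; first exact: (subset_trans XA AA').
    move=> _ [x [y [/AY Yx uy ->]]]; apply: YD => //.
    by move: y uy; apply: lspan_min => // _ ->.
  apply: (sartinian_ext Rr SM _ As A's XA AA') => //.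
  apply: (@sartinian_cyclic _ _ _ _ Rr (fun _ _ => I) A _ u As) => [|b _].
    move=> _ [x [y [Ax uy ->]]].
    have [|b [w [_ /lspan_seq_nil -> ->]]] :=
        @lspan_seq_cons _ _ _ u [::] Rr y.
      by apply: lspan_mono uy => _ ->; apply: mem_head.
    by exists b, x; rewrite addr0 addrC.
  by case: (annP b) => [|[t ?]]; [left|right; exists t].
by move=> x Ax; exists x, 0; rewrite addr0; split=> //; case: us => -[].
Qed.

End Artinian.

(* The complement of S is a minimal prime over I. *)
Lemma maximal_multiplicative (R : comPzRingType) (I : set R^o) :
  submod setT I -> ~ I 1 ->
  exists S : set R, [/\ S 1, forall s t, S s -> S t -> S (s * t),
    forall s, S s -> ~ I s &
    forall r, S r \/ exists s i, S s /\ I (s * r ^+ i)].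
Proof.
move=> [[I0 ID] IZ] nI1.
(* [P] does not ask for 1, so that the empty chain has an upper bound; maximality gives 1 back. *)
pose P (S : set R) := (forall s t, S s -> S t -> S (s * t)) /\ forall s, S s -> ~ I s.
have [C CP totC|S [[SM SI] Smax]] := @Zorn_bigcup R P.
  split; last by move=> s [X /CP[_ XI] /XI].
  move=> s t [X CX Xs] [Y CY Yt].
  have [XY|YX] := totC _ _ CX CY.
    by exists Y => //; case: (CP _ CY) => YM _; apply: YM => //; apply: XY.
  by exists X => //; case: (CP _ CX) => XM _; apply: XM => //; apply: YX.
have S1 : S 1.
  apply: contrapT => nS1; case: (Smax (S `|` [set 1])).
    by split; [move=> x; left|move=> H; apply/nS1/H; right].
  split; last by move=> s [/SI//|->].
  move=> s t [Ss|->] [St|->]; rewrite ?mul1r ?mulr1; try (by left); last by right.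
  by left; apply: SM.
exists S; split=> // r; apply: contrapT => /not_orP[nSr nr].
(* Adjoining [r] to [S] contradicts maximality unless some [s * r ^+ i] lies in [I]. *)
case: (Smax [set y | exists s i, S s /\ y = s * r ^+ i]).
  split; first by move=> s Ss; exists s, 0%N; rewrite expr0 mulr1.
  by move=> H; apply/nSr/H; exists 1, 1%N; rewrite mul1r expr1.
split=> [_ _ [s [i [Ss ->]]] [t [j [St ->]]]|_ [s [i [Ss ->]]] Is].
  by exists (s * t), (i + j)%N; rewrite mulrACA exprD; split=> //; apply: SM.
by apply: nr; exists s, i.
Qed.

(** These are the p^(-e)-linear maps, with [e] depending on the map. Positivity of [e] makes [p ^ e]
    at least 2, the source of all contraction below. *)
Definition plinear (p : nat) (R : comPzRingType) (V : lmodType R) (phi : V -> V) :=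
  additive_map phi /\
  exists e, (0 < e)%N /\ forall r m, r *: phi m = phi (r ^+ (p ^ e) *: m).

Section Operators.
Variables (p : nat) (R : comPzRingType) (V : lmodType R).
Hypothesis p_gt1 : (1 < p)%N.
Implicit Types (Op : set (V -> V)) (N : set V).

Definition image_sum Op N : set V :=
  gen [set y | exists phi m, [/\ Op phi, N m & y = phi m]].

Lemma image_sum_mono Op Op' N N' : Op `<=` Op' -> N `<=` N' ->
  image_sum Op N `<=` image_sum Op' N'.
Proof.
move=> OO' NN'; apply: gen_mono => _ [phi [m [/OO' Of /NN' Nm ->]]].
by exists phi, m.
Qed.

Lemma image_sum_submod Op N : Op `<=` plinear p (V := V) -> submod setT N ->
  submod setT (image_sum Op N).
Proof.
move=> Opl [_ NZ]; split; first exact: gen_closed.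
move=> r x _; apply: (gen_preim (h := fun x => r *: x)).
- by split; [rewrite scaler0|move=> *; rewrite scalerDr].
- exact: gen_closed.
move=> _ [phi [m [Of Nm ->]]].
have [_ [e [_ He]]] := Opl _ Of; rewrite He.
by apply: mem_gen; exists phi, (r ^+ (p ^ e) *: m); split=> //; apply: NZ.
Qed.

Lemma iter_image_sum_submod Op n : Op `<=` plinear p (V := V) ->
  submod setT (iter n (image_sum Op) setT).
Proof. by move=> Opl; elim: n => [|n IH] //=; apply: image_sum_submod. Qed.

Lemma expn_pe_ge2 e : (0 < e)%N -> (2 <= p ^ e)%N.
Proof. by case: e => // e _; rewrite expnS -[2%N]muln1 leq_mul // expn_gt0 ltnW. Qed.

(** Inside an operator [r] becomes a power of exponent at least 2, so two factors [r] are available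
    to carry [N] into [N']. *)
Lemma scale_image_sum Op N N' r : Op `<=` plinear p (V := V) ->
  submod setT N' -> (forall x, N x -> N' (r *: (r *: x))) ->
  forall x, image_sum Op N x -> image_sum Op N' (r *: x).
Proof.
move=> Opl [_ N'Z] NN' x; apply: (gen_preim (h := fun x => r *: x)).
- by split; [rewrite scaler0|move=> *; rewrite scalerDr].
- exact: gen_closed.
move=> _ [phi [m [Of Nm ->]]].
have [_ [e [/expn_pe_ge2 q2 He]]] := Opl _ Of; rewrite He.
apply: mem_gen; exists phi, (r ^+ (p ^ e) *: m); split=> //.
rewrite -(subnK q2) exprD -scalerA; apply: N'Z => //.
by rewrite expr2 -scalerA; apply: NN'.
Qed.

Section Stability.
Variables (gs : seq V) (Op : set (V -> V)).
Hypotheses (Rn : noeth [set: R]) (Vgs : lspan_seq setT gs = setT).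
Hypothesis Opl : Op `<=` plinear p (V := V).

Let T n := iter n (image_sum Op) setT.

Let Ts n : submod setT (T n). Proof. exact: iter_image_sum_submod. Qed.

Let TS n : T n.+1 `<=` T n.
Proof. by elim: n => [//|n IH]; rewrite /T !iterS; apply: image_sum_mono. Qed.

Let T_le m n : (m <= n)%N -> T n `<=` T m.
Proof.
move=> /subnK <-; elim: (n - m)%N => [//|i IH]; rewrite addSn.
exact: (subset_trans (@TS _) IH).
Qed.

(* With I_n = Ann (T_n / T_(n+1)), the p-linear operators make the chain I_n
   ascending; once it is stationary with value I, the square of I maps the
   chain into its intersection, and localizing at a minimal prime of I makes
   the quotient by this intersection artinian. *)
Theorem stable_image_sum :
  exists n0, forall n, (n0 <= n)%N -> T n = T n0.
Proof.
pose I n : set R^o := [set r | forall x, T n x -> T n.+1 (r *: x)].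
have Is n : submod setT (I n).
  have [[T0 TD] TZ] := Ts n.+1; split; first split.
  - by move=> x _; rewrite scale0r.
  - by move=> r r' Ir Ir' x Tx; rewrite scalerDl; apply: TD; [apply: Ir|apply: Ir'].
  by move=> b r _ Ir x Tx; rewrite -scalerA; apply: TZ => //; apply: Ir.
have IS n : I n `<=` I n.+1.
  move=> r Ir x; apply: (scale_image_sum Opl (Ts n.+1)) => y Ty.
  by have [_ TZ] := Ts n.+1; apply: TZ => //; apply: Ir.
have I_le m n : (m <= n)%N -> I m `<=` I n.
  move=> /subnK <-; elim: (n - m)%N => [//|i IH]; rewrite addSn.
  exact: (subset_trans IH (@IS _)).
have [||_ [[n0 _ <-] Imax]] := noeth_maximal Rn (F := range I) (regular_span R).
- by exists (I 0%N); exists 0%N.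
- by move=> _ [n _ <-].
have IE n : (n0 <= n)%N -> I n `<=` I n0.
  by move=> le; apply: Imax (I_le _ _ le); exists n.
have [I1|nI1] := pselect (I n0 1).
  exists n0 => n /subnK <-; elim: (n - n0)%N => [//|i IH]; rewrite addSn -[RHS]IH.
  apply/seteqP; split; first exact: TS.
  move=> x Tx; rewrite -[x]scale1r; exact: (I_le _ _ (leq_addl i n0)).
have I2 n a b x : I n0 a -> I n0 b -> T n0 x -> T (n + n0)%N (a *: (b *: x)).
  elim: n a b x => [|n IH] a b x Ia Ib Tx.
    by have [_ TZ] := Ts n0; rewrite add0n; apply: (TZ) => //; apply: TZ.
  have := Ib _ Tx; rewrite addSn; apply: (scale_image_sum Opl (Ts _)) => y Ty.
  exact: IH.
have [S [S1 SM SI SP]] := maximal_multiplicative (Is n0) nI1.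
pose X : set V := [set x | forall n, T (n + n0)%N x].
have Xs : submod setT X.
  split; first split.
  - by move=> n; case: (Ts (n + n0)) => -[].
  - by move=> x y Xx Xy n; case: (Ts (n + n0)) => -[_ TD] _; apply: TD.
  by move=> b x _ Xx n; case: (Ts (n + n0)) => _; apply.
have XT : X `<=` T n0 by move=> x /(_ 0%N).
have [|||_ [[n _ <-] Tmin]] := sartinian_noeth Rn S1 SM Vgs Xs (Ts n0) XT _
    (F := [set T (n + n0)%N | n in setT]).
- move=> r; have [|[s [i [Ss Isr]]]] := SP r; first by left.
  (* The square of [s * r ^+ i] is taken because products of two elements of [I n0] map [T n0] into
     [X]. *)
  right; exists (s * s), (i + i)%N; split; first exact: SM.
  move=> y Ty n; have -> : s * s *: (r ^+ (i + i) *: y) =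
      (s * r ^+ i) *: ((s * r ^+ i) *: y) by rewrite !scalerA exprD mulrACA.
  exact: I2.
- by exists (T n0); exists 0%N.
- by move=> _ [n _ <-]; split=> //; apply: T_le (leq_addl _ _).
(* Minimality yields one [t] in [S] that lies in [I (n + n0)], hence in [I n0], which is disjoint
   from [S]. *)
have [|t [St Ht]] := sle_fin_gen S1 SM (Ts (n.+1 + n0)) _
    (Tmin _ (imageP _ (Logic.I : setT n.+1)) (@TS _)).
  apply: (noeth_module (subring_setT R) Rn (gs := gs)) => //.
  by rewrite Vgs.
case: (SI _ St); apply: (IE _ (leq_addl n n0)) => x; exact: Ht.
Qed.
End Stability.
End Operators.

(** * Gauges *)

Lemma add_closed_sum (V : nmodType) (N : set V) (I : Type) (s : seq I) (F : I -> V) :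
  add_closed N -> (forall i, N (F i)) -> N (\sum_(i <- s) F i).
Proof. by case=> N0 ND HF; apply: big_ind. Qed.

Lemma F_finite_iter (p : nat) (k : fieldType) (e : nat) :
  p \in [pchar k] -> F_finite p k ->
  exists bs : seq k, forall c,
    gen [set y | exists d b, b \in bs /\ y = d ^+ (p ^ e) * b] c.
Proof.
move=> pk [m [b bP]]; elim: e => [|e [bs IH]].
  exists [:: 1] => c; apply: mem_gen; exists c, 1.
  by rewrite expn0 expr1 mulr1 mem_head.
(* The p-th powers of [bs] span k^p over the (p^(e+1))-th powers, and the [b i] span k over k^p. *)
exists [seq b' ^+ p * b i | b' <- bs, i <- enum 'I_m] => c.
have [a ->] := bP c; apply: add_closed_sum; first exact: gen_closed.
move=> i; apply: (gen_preim (h := fun y => y ^+ p * b i)) (IH (a i)).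
- split=> [|x y]; first by rewrite expr0n -leqn0 leqNgt (prime_gt0 (pcharf_prime pk)) mul0r.
  rewrite -mulrDl -!(pFrobenius_autE pk).
  by rewrite pFrobenius_autD_comm //; apply: mulrC.
- exact: gen_closed.
move=> _ [d [b' [b's ->]]]; apply: mem_gen; exists d, (b' ^+ p * b i); split.
  by apply/allpairsP; exists (b', i); rewrite mem_enum.
by rewrite exprMn -exprM -expnSr mulrA.
Qed.

Section Gauge.
Variables (p : nat) (k : fieldType) (pk : p \in [pchar k]) (kF : F_finite p k).
Variables (R : comPzRingType) (f : {rmorphism k -> R}) (n : nat) (x : 'I_n -> R).
Variables (V : lmodType R) (gs : seq V).
Hypothesis Rx : smallest (fun A : set R => subring_closed (mem A))
  (range f `|` range x) = setT.
Hypothesis Vgs : lspan_seq setT gs = setT.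

Definition monomial (a : 'I_n -> nat) : R := \prod_i x i ^+ a i.

Lemma monomialM a b : monomial a * monomial b = monomial (fun i => a i + b i)%N.
Proof. by rewrite /monomial -big_split; apply: eq_bigr => i _; rewrite exprD. Qed.

(** Each exponent is bounded separately, since division by [p ^ e] will act on each exponent by
    itself. *)
Definition gauge_ring d : set R :=
  gen [set y | exists c a, (forall i, (a i <= d)%N) /\ y = f c * monomial a].

Definition gauge d : set V := lspan (gauge_ring d) [set g | g \in gs].

Lemma gauge_ring_mono d d' : (d <= d')%N -> gauge_ring d `<=` gauge_ring d'.
Proof.
move=> le; apply: gen_mono => _ [c [a [ad ->]]]; exists c, a; split=> // i.
exact: leq_trans (ad i) le.
Qed.

Lemma gauge_mono d d' : (d <= d')%N -> gauge d `<=` gauge d'.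
Proof.
move=> le; apply: gen_mono => _ [b [g [gb gg ->]]]; exists b, g; split=> //.
exact: gauge_ring_mono gb.
Qed.

Lemma gauge_ringM d d' a b : gauge_ring d a -> gauge_ring d' b ->
  gauge_ring (d + d') (a * b).
Proof.
move=> ga; apply: (gen_preim (h := fun b => a * b)).
- by split; [rewrite mulr0|move=> *; rewrite mulrDr].
- exact: gen_closed.
move=> _ [c [u [ud ->]]].
apply: (gen_preim (h := fun a => a * (f c * monomial u))) ga.
- by split; [rewrite mul0r|move=> *; rewrite mulrDl].
- exact: gen_closed.
move=> _ [c' [w [wd ->]]]; apply: mem_gen; exists (c' * c), (fun i => w i + u i)%N.
by split=> [i|]; rewrite ?leq_add // mulrACA monomialM rmorphM.
Qed.

Lemma gauge_scale d d' r v : gauge_ring d r -> gauge d' v -> gauge (d + d') (r *: v).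
Proof.
move=> gr; apply: (gen_preim (h := fun v => r *: v)).
- by split; [rewrite scaler0|move=> *; rewrite scalerDr].
- exact: gen_closed.
move=> _ [b [g [gb gg ->]]]; apply: mem_gen; exists (r * b), g.
by rewrite scalerA; split=> //; apply: gauge_ringM.
Qed.

Lemma gauge_ring_term d c a : (forall i, (a i <= d)%N) -> gauge_ring d (f c * monomial a).
Proof. by move=> ad; apply: mem_gen; exists c, a. Qed.

Lemma monomial0 : monomial (fun=> 0%N) = 1.
Proof. by apply: big1 => i _; rewrite expr0. Qed.

Lemma gauge_ring_exhaust r : exists d, gauge_ring d r.
Proof.
suff : [set: R] `<=` [set r | exists d, gauge_ring d r] by apply.
have c0 c : gauge_ring 0 (f c).
  by rewrite -[f c]mulr1 -monomial0; apply: gauge_ring_term.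
rewrite -Rx; apply: smallest_sub.
  split; first by rewrite inE; exists 0%N; rewrite -(rmorph1 f).
  - move=> a b; rewrite !inE => -[d da] [e eb]; exists (maxn d e); apply: gen_add.
      exact: gauge_ring_mono (leq_maxl _ _) _ da.
    rewrite -mulN1r -[maxn d e]add0n; apply: gauge_ringM.
      by rewrite -(rmorph1 f) -rmorphN.
    exact: gauge_ring_mono (leq_maxr _ _) _ eb.
  move=> a b; rewrite !inE => -[d da] [e eb]; exists (d + e)%N.
  exact: gauge_ringM.
move=> _ [[c _ <-]|[i _ <-]]; first by exists 0%N.
exists 1%N; have -> : x i = f 1 * monomial (fun j => (j == i : nat)).
  rewrite rmorph1 mul1r /monomial (bigD1 i) //= eqxx expr1 big1 ?mulr1 // => j /negbTE ->.
  by rewrite expr0.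
by apply: gauge_ring_term => j; apply: leq_b1.
Qed.

Lemma gauge_exhaust v : exists d, gauge d v.
Proof.
suff : [set: V] `<=` [set v | exists d, gauge d v] by apply.
rewrite -Vgs; apply: gen_min; first split.
- by exists 0%N; apply: gen0.
- move=> u w [d du] [e ew]; exists (maxn d e); apply: gen_add.
    exact: gauge_mono (leq_maxl _ _) _ du.
  exact: gauge_mono (leq_maxr _ _) _ ew.
move=> _ [r [g [_ gg ->]]]; have [d dr] := gauge_ring_exhaust r.
by exists d; apply: mem_gen; exists r, g.
Qed.

Lemma gauge_exhaust_seq (s : seq V) : exists d, [set v | v \in s] `<=` gauge d.
Proof.
elim: s => [|v s [d sd]]; first by exists 0%N.
have [e ev] := gauge_exhaust v; exists (maxn d e) => w /=; rewrite inE.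
move=> /predU1P[->|/sd]; first exact: gauge_mono (leq_maxr _ _) _ ev.
exact: gauge_mono (leq_maxl _ _) _.
Qed.

Lemma gauge_finite d : exists ws : seq V, gauge d `<=` lspan_seq (range f) ws.
Proof.
pose mon (a : {ffun 'I_n -> 'I_d.+1}) := monomial (fun i => a i).
exists [seq mon a *: g | a <- enum {ffun 'I_n -> 'I_d.+1}, g <- gs].
apply: gen_min; first exact: gen_closed.
move=> _ [r [g [gr gg ->]]].
apply: (gen_preim (h := fun r => r *: g)) gr.
- by split; [rewrite scale0r|move=> *; rewrite scalerDl].
- exact: gen_closed.
move=> _ [c [a [ad ->]]]; apply: mem_gen; exists (f c), (monomial a *: g).
split; [by exists c| |by rewrite scalerA].
apply/allpairsP; exists ([ffun i => inord (a i)], g) => /=; rewrite mem_enum; split=> //.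
by congr (_ *: _); apply: eq_bigr => i _; rewrite ffunE inordK // ltnS.
Qed.

(* Division of exponents by q = p ^ e: r is a sum of q-th powers times terms
   with exponents less than q and coefficients in a fixed finite set. *)
Lemma gauge_ring_div e : exists bs : seq k, forall d r, gauge_ring d r ->
  gen [set y | exists r' b (a : {ffun 'I_n -> 'I_(p ^ e)}),
    [/\ b \in bs, gauge_ring (d %/ p ^ e) r' &
        y = r' ^+ (p ^ e) * (f b * monomial (fun i => a i))]] r.
Proof.
have [bs bsP] := F_finite_iter e pk kF; exists bs => d r.
have q0 : (0 < p ^ e)%N by rewrite expn_gt0 (prime_gt0 (pcharf_prime pk)).
apply: gen_min; first exact: gen_closed.
move=> _ [c [a [ad ->]]].
apply: (gen_preim (h := fun c => f c * monomial a)) (bsP c).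
- by split; [rewrite rmorph0 mul0r|move=> *; rewrite rmorphD mulrDl].
- exact: gen_closed.
move=> _ [c' [b [bbs ->]]]; apply: mem_gen.
exists (f c' * monomial (fun i => a i %/ p ^ e)%N), b.
exists [ffun i => Ordinal (ltn_pmod (a i) q0)]; split=> //.
  by apply: gauge_ring_term => i; apply: leq_div2r.
rewrite rmorphM rmorphXn exprMn -!mulrA; congr (_ * _); rewrite mulrCA; congr (_ * _).
rewrite /monomial -prodrXl -big_split; apply: eq_bigr => i _.
by rewrite ffunE /= -exprM -exprD -divn_eq.
Qed.

(** Write a coefficient as a sum of q-th powers times reduced terms, where q = p ^ e. The q-th roots
    leave [phi] with exponents divided by q, and [K] bounds the finitely many values of [phi] on
    reduced terms times generators. Applied to coefficients over elements of [N] of gauge [d], the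
    same division produces generators of small gauge. [N'] is left free so that the images of
    several operators can share it. *)
Lemma plinear_gauge (phi : V -> V) : plinear p phi ->
  exists K, forall d (N N' : set V), submod setT N -> N `<=` lspan setT (N `&` gauge d) ->
    (forall v, N v -> N' (phi v)) ->
    forall v, N v -> lspan setT (N' `&` gauge (d %/ 2 + K)) (phi v).
Proof.
move=> [[phi0 phiD] [e [e_gt0 phiq]]].
have q_gt1 : (1 < p ^ e)%N by apply: expn_pe_ge2; rewrite ?prime_gt1 // (pcharf_prime pk).
have phi_scale g : additive_map (fun r => phi (r *: g)).
  by split=> [|u v]; rewrite ?scale0r // scalerDl phiD.
have [bs bsP] := gauge_ring_div e.
pose mon (a : {ffun 'I_n -> 'I_(p ^ e)}) := monomial (fun i => a i).
have [K KP] := gauge_exhaust_seq [seq phi ((f ba.1 * mon ba.2) *: g) |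
  ba <- [seq (b, a) | b <- bs, a <- enum {ffun 'I_n -> 'I_(p ^ e)}], g <- gs].
have bound d v : gauge d v -> gauge (d %/ p ^ e + K) (phi v).
  apply: (gen_preim (h := phi)) => //; first exact: gen_closed.
  move=> _ [r [g [/bsP gr gg ->]]].
  apply: (gen_preim (h := fun r => phi (r *: g))) gr => //; first exact: gen_closed.
  move=> _ [r' [b [a [bbs gr' ->]]]]; rewrite -scalerA -phiq.
  apply: gauge_scale => //; apply: KP; apply/allpairsP; exists ((b, a), g); split=> //.
  by apply/allpairsP; exists (b, a); rewrite mem_enum.
(* The extra 1 absorbs the exponents of the reduced terms: (q - 1 + d) / q is at most d / 2 + 1. *)
exists K.+1 => d N N' [_ NZ] Ngen NN' v Nv.
move: (Ngen _ Nv); apply: (gen_preim (h := phi)) => //; first exact: gen_closed.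
move=> _ [r [h [_ [Nh gh] ->]]]; have [D gr] := gauge_ring_exhaust r.
apply: (gen_preim (h := fun r => phi (r *: h))) (bsP _ _ gr) => //; first exact: gen_closed.
move=> _ [r' [b [a [_ _ ->]]]]; rewrite -scalerA -phiq.
apply: mem_gen; exists r', (phi ((f b * monomial (fun i => a i)) *: h)); split=> //; split.
  by apply/NN'/NZ.
have : gauge ((p ^ e).-1 + d) ((f b * monomial (fun i => a i)) *: h).
  apply: gauge_scale => //; apply: gauge_ring_term => i.
  by rewrite -ltnS prednK // ltnW.
move=> /bound; apply: gauge_mono; rewrite addnS -addSn leq_add2r.
rewrite (leq_trans (n := (d + p ^ e) %/ p ^ e)) //.
  by apply: leq_div2r; rewrite addnC leq_add2l leq_pred.
by rewrite divnDr // divnn (ltnW q_gt1) addn1 ltnS leq_div2l.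
Qed.

Lemma contraction_radius (phis : seq (V -> V)) :
  [set phi | phi \in phis] `<=` plinear p (V := V) ->
  exists K, forall d (N : set V), submod setT N -> N `<=` lspan setT (N `&` gauge d) ->
    let N' := image_sum [set phi | phi \in phis] N in
    N' `<=` lspan setT (N' `&` gauge (d %/ 2 + K)).
Proof.
move=> phisl.
have [K KP] : exists K, forall phi, phi \in phis ->
    forall d (N N' : set V), submod setT N -> N `<=` lspan setT (N `&` gauge d) ->
    (forall v, N v -> N' (phi v)) ->
    forall v, N v -> lspan setT (N' `&` gauge (d %/ 2 + K)) (phi v).
  elim: phis phisl => [|phi phis IH] phisl; first by exists 0%N.
  have [psi psis|K KP] := IH; first by apply: phisl; rewrite /= inE psis orbT.
  have [K' K'P] := plinear_gauge (phisl _ (mem_head _ _)).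
  exists (maxn K K') => psi; rewrite inE => /predU1P[->|psis] d N N' Ns Ng NN' v Nv.
    apply: lspan_mono (K'P _ _ _ Ns Ng NN' _ Nv) => w [? gw]; split=> //.
    by apply: gauge_mono gw; rewrite leq_add2l leq_maxr.
  apply: lspan_mono (KP _ psis _ _ _ Ns Ng NN' _ Nv) => w [? gw]; split=> //.
  by apply: gauge_mono gw; rewrite leq_add2l leq_maxl.
exists K => d N Ns Ng N'; apply: gen_min; first exact: gen_closed.
move=> _ [phi [v [phiP Nv ->]]]; apply: (KP _ phiP _ N) => // w Nw.
by apply: mem_gen; exists phi, w.
Qed.

(** Above [K.*2] the map strictly decreases [d]. *)
Lemma iter_half K d : exists j, (iter j (fun d => d %/ 2 + K) d <= K.*2)%N.
Proof.
have [m] := ubnP d; elim: m d => // m IH d dm.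
have [le|lt] := leqP d K.*2; first by exists 0%N.
have [|j Hj] := IH (d %/ 2 + K)%N; last by exists j.+1; rewrite iterSr.
by move: dm lt; rewrite -muln2; lia.
Qed.

(** Induction on dimension in terms of [sartinian]. The elements of [S] are invertible, so on
    k-subspaces [sle] amounts to inclusion, and each vector of [ws] adds at most one dimension. *)
Lemma sartinian_finite_dim (ws : seq V) :
  sartinian (range f) [set r | exists c, c != 0 /\ r = f c]
    [set 0] (lspan_seq (range f) ws).
Proof.
set S := (X in sartinian _ X); have Br := range_subring f.
have S1 : S 1 by exists 1; rewrite oner_neq0 rmorph1.
have SM s t : S s -> S t -> S (s * t).
  by move=> [c [c0 ->]] [d [d0 ->]]; exists (c * d); rewrite mulf_neq0 ?rmorphM.
have SB : S `<=` range f by move=> _ [c [_ ->]]; exists c.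
have nil_sub (s : seq V) : [set 0] `<=` lspan_seq (range f) s by move=> _ ->; apply: gen0.
have ls (s : seq V) : submod (range f) (lspan_seq (range f) s) by apply: lspan_submod.
elim: ws => [|g ws IH].
  apply: sartinian_sle => //; apply: sle_sub => //; exact: lspan_seq_nil.
apply: (sartinian_ext Br SM SB (ls ws) (ls (g :: ws)) (nil_sub ws) _ IH).
  by apply: lspan_mono => h /=; rewrite inE orbC => ->.
apply: (sartinian_cyclic Br SB (g := g)) => //.
  by move=> y /(lspan_seq_cons Br) [b [w ?]]; exists b, w.
move=> _ [c _ <-]; have [->|c0] := eqVneq c 0; last by left; exists c.
by right; exists 1; rewrite rmorph0 scale0r scaler0; split=> //; apply: gen0.
Qed.

(* Among the R-submodules generated by a fixed finite-dimensional k-subspace of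
   V, a family has a minimal member; the gauge puts all large iterates of
   image_sum in this situation. *)
Lemma least_compatible_finite (phis : seq (V -> V)) (S : set R) (U : set V) :
  noeth [set: R] -> [set phi | phi \in phis] `<=` plinear p (V := V) ->
  S 1 -> (forall s t, S s -> S t -> S (s * t)) -> submod setT U ->
  U `<=` image_sum [set phi | phi \in phis] U ->
  exists G : set V, (exists s, S s /\ forall u, U u -> G (s *: u)) /\
    forall N, submod setT N -> image_sum [set phi | phi \in phis] N `<=` N ->
      (exists s, S s /\ forall u, U u -> N (s *: u)) -> G `<=` N.
Proof.
move=> Rn phisl S1 SM Us UT; set T := image_sum [set phi | phi \in phis] in UT *.
have [K KP] := contraction_radius phisl.
have [ws Wws] := gauge_finite K.*2; set W := lspan_seq (range f) ws in Wws.
pose good N := [/\ submod setT N, T N `<=` N &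
  exists s, S s /\ forall u, U u -> N (s *: u)].
(* The same [s] serves [T N]: [U] lies in [T U], and under the operators [s] turns into a power of
   itself. *)
have goodT N : good N -> good (T N).
  move=> [Ns TN [s [Ss sN]]]; split.
  - exact: (image_sum_submod phisl).
  - exact: image_sum_mono.
  exists s; split=> // u /UT; apply: (scale_image_sum _ phisl Ns) => [|v Uv].
    exact: prime_gt1 (pcharf_prime pk).
  by case: Ns => _ NZ; apply: NZ => //; apply: sN.
have below N : good N -> exists G, [/\ good G, G `<=` N & G `<=` lspan setT (G `&` W)].
  move=> Ng; have [Ns TN _] := Ng.
  have [|hs [hsN Nhs]] := noeth_module (subring_setT R) Rn (gs := gs) Ns.
    by rewrite Vgs.
  have [d dhs] := gauge_exhaust_seq hs; have [j jK] := iter_half K d.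
  have [Gg GN Ggen] : [/\ good (iter j T N), iter j T N `<=` N &
      iter j T N `<=` lspan setT (iter j T N `&` gauge (iter j (fun d => d %/ 2 + K)%N d))].
    elim: {jK} j => [|j [Gg GN Ggen]] /=.
      by split=> //; apply: (subset_trans Nhs); apply: lspan_mono => h /= hh; split; auto.
    have [Gs TG _] := Gg; split; first exact: goodT.
      exact: (subset_trans TG GN).
    exact: KP.
  exists (iter j T N); split=> //; apply: (subset_trans Ggen); apply: lspan_mono.
  by move=> v [Gv gv]; split=> //; apply: Wws; apply: gauge_mono gv.
have subB N : submod setT N -> submod (range f) N.
  by case=> ? NZ; split=> // b v _; apply: NZ.
have Br := range_subring f.
have Ws : submod (range f) W by apply: lspan_submod.
(* Minimality concerns the traces on [W], which are finite-dimensional; each [G] in [F] is recovered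
   from its trace. *)
pose F : set (set V) := [set G | good G /\ G `<=` lspan setT (G `&` W)].
have [||_ [[G [Gg Ggen] <-] Gmin]] :=
    sartinian_finite_dim (ws := ws) (F := [set G `&` W | G in F]).
- have [|G [Gg _ Ggen]] := below setT; last by exists (G `&` W); exists G.
  by split=> //; exists 1.
- move=> _ [G [[Gs _ _] _] <-]; split; [|move=> _ ->|exact: subIsetr].
    by apply: submodI => //; apply: subB.
  by split; [case: Gs => -[]|apply: gen0].
exists G; split; first by case: Gg.
move=> N Ns TN [s [Ss sN]]; have [Gs TG [t [St tG]]] := Gg.
(* A member of [F] below the intersection of [G] and [N] has, by minimality, the same trace on [W]
   as [G], and this trace generates [G]. *)
have [|G' [Gg' G'GN G'gen]] := below (G `&` N).
  split; first exact: submodI.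
    by move=> v Tv; split; [apply: TG|apply: TN]; apply: image_sum_mono Tv.
  exists (s * t); split; first exact: SM.
  move=> u Uu; split; first by rewrite -scalerA; case: Gs => _; apply=> //; apply: tG.
  by rewrite mulrC -scalerA; case: Ns => _; apply=> //; apply: sN.
suff GW : G `&` W `<=` G'.
  apply: (subset_trans Ggen); have [G's _ _] := Gg'.
  by apply: (@subset_trans _ G'); [apply: lspan_min|move=> v /G'GN[]].
move=> v GWv; have [|||_ [[c [c0 ->]] [G'cv _]]] := Gmin (G' `&` W) _ _ v.
- by exists G'.
- by move=> w [/G'GN[Gw _] Ww].
- exact: GWv.
have -> : v = f c^-1 *: (f c *: v) by rewrite scalerA -rmorphM mulVf // rmorph1 scale1r.
by case: Gg' => -[_ G'Z] _ _; apply: G'Z.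
Qed.

(** Reduction to finitely many operators: each of the finitely many generators of [U] is a finite
    sum of operator values. Stability under [Op] implies stability under the selected operators, so
    their [G] still lies below every [N] considered. *)
Lemma least_compatible (Op : set (V -> V)) (S : set R) (U : set V) :
  noeth [set: R] -> Op `<=` plinear p (V := V) ->
  S 1 -> (forall s t, S s -> S t -> S (s * t)) -> submod setT U ->
  image_sum Op U = U ->
  exists G : set V, (exists s, S s /\ forall u, U u -> G (s *: u)) /\
    forall N, submod setT N -> image_sum Op N `<=` N ->
      (exists s, S s /\ forall u, U u -> N (s *: u)) -> G `<=` N.
Proof.
move=> Rn Opl S1 SM Us TU.
have [|us [usU Uus]] := noeth_module (subring_setT R) Rn (gs := gs) Us.
  by rewrite Vgs.
have imfin v : image_sum Op U v -> exists phis : seq (V -> V),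
    [set phi | phi \in phis] `<=` Op /\ image_sum [set phi | phi \in phis] U v.
  elim=> [|_ {}v [phi [m [Of Um ->]]] _ [phis [phisO IH]]].
    by exists [::]; split=> //; apply: gen0.
  exists (phi :: phis); split=> [psi /=|].
    by rewrite inE => /predU1P[->|/phisO].
  apply: gen_add; first by apply: mem_gen; exists phi, m; split=> //; apply: mem_head.
  by apply: image_sum_mono IH => // psi /=; rewrite inE orbC => ->.
have [phis [phisO usT]] : exists phis : seq (V -> V), [set phi | phi \in phis] `<=` Op /\
    [set u | u \in us] `<=` image_sum [set phi | phi \in phis] U.
  elim: us usU {Uus} => [|u us IH] usU; first by exists [::].
  have [v vus|phis [phisO usT]] := IH; first by apply: usU; rewrite /= inE vus orbT.
  have [|psis [psisO uT]] := imfin u; first by rewrite TU; apply: usU; apply: mem_head.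
  exists (phis ++ psis); split=> [phi /=|v /=].
    by rewrite mem_cat => /orP[/phisO|/psisO].
  rewrite inE => /predU1P[->|/usT].
    by apply: image_sum_mono uT => // phi /=; rewrite mem_cat orbC => ->.
  by apply: image_sum_mono => // phi /=; rewrite mem_cat => ->.
have phisl : [set phi | phi \in phis] `<=` plinear p (V := V).
  exact: (subset_trans phisO Opl).
have [|G [sG Gmin]] := least_compatible_finite Rn phisl S1 SM Us.
  apply: (subset_trans Uus); apply: lspan_min => //.
  exact: (image_sum_submod phisl).
exists G; split=> // N Ns TN; apply: Gmin => //.
by apply: subset_trans TN => //; apply: image_sum_mono.
Qed.

End Gauge.

(** * Modules over Cartier algebras *)

(** An alias of [M] that carries the [R]-module structure, kept apart from the [C]-module
    structure. *)
Definition restriction (R : comPzRingType) (C : pzRingType)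
  (iota : {rmorphism R -> C}) (M : lmodType C) : Type := M.

Section Restriction.
Variables (R : comPzRingType) (C : pzRingType) (iota : {rmorphism R -> C}).
Variable M : lmodType C.

HB.instance Definition _ := GRing.Zmodule.copy (restriction iota M) M.

Let scale (r : R) (m : restriction iota M) : restriction iota M := iota r *: (m : M).

Let scaleA a b v : scale a (scale b v) = scale (a * b) v.
Proof. by rewrite /scale scalerA -rmorphM. Qed.

Let scale1 : left_id 1 scale.
Proof. by move=> v; rewrite /scale rmorph1 scale1r. Qed.

Let scaleDr : right_distributive scale +%R.
Proof. by move=> a u v; apply: scalerDr. Qed.

Let scaleDl v : {morph scale^~ v : a b / a + b}.
Proof. by move=> a b; rewrite /scale rmorphD scalerDl. Qed.

HB.instance Definition _ :=
  GRing.Zmodule_isLmodule.Build R (restriction iota M) scaleA scale1 scaleDr scaleDl.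

Lemma restriction_scaleE (r : R) (m : restriction iota M) : r *: m = iota r *: (m : M).
Proof. by []. Qed.

End Restriction.

Section CartierModule.
Variables (p : nat) (R : comPzRingType) (C : pzRingType).
Variables (iota : {rmorphism R -> C}) (Cg : nat -> set C).
Hypothesis C_cartier : is_cartier_algebra p iota Cg.
Variable M : lmodType C.
Let V : lmodType R := restriction iota M.

Lemma is_submoduleP (N : set M) :
  is_submodule N <-> add_closed N /\ forall c x, N x -> N (c *: x).
Proof.
split=> [[N0 NL]|[[N0 ND] NZ]].
  rewrite inE in N0; have NZ c x : N x -> N (c *: x).
    move=> Nx; have := NL c x 0; rewrite !inE addr0; exact.
  split=> //; split=> // x y Nx Ny.
  by have := NL 1 x y; rewrite !inE scale1r; apply.
split; first by rewrite inE.
by move=> c x y; rewrite !inE => Nx Ny; apply: ND => //; apply: NZ.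
Qed.

Lemma submodule_restriction (N : set M) : is_submodule N -> @submod R V setT N.
Proof.
by move=> /is_submoduleP[Na NZ]; split=> // r x _; rewrite restriction_scaleE; apply: NZ.
Qed.

(** Only homogeneous elements are taken, since they are p-linear with a single exponent; the sums in
    [image_sum] restore the rest of the irrelevant part. *)
Definition cartier_op : set (V -> V) :=
  [set phi | exists e c, [/\ (0 < e)%N, Cg e c & phi = fun m => c *: (m : M)]].

Lemma cartier_op_plinear : cartier_op `<=` plinear p (V := V).
Proof.
move=> _ [e [c [e0 Cc ->]]]; split.
  by split=> [|u v]; rewrite ?scaler0 ?scalerDr.
exists e; split=> // r m; rewrite !restriction_scaleE !scalerA.
by rewrite (cartier_comm C_cartier r Cc).
Qed.

(** Each homogeneous component of a scalar times [phi] is again homogeneous of positive degree. *)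
Lemma cartier_op_submodule (N : set M) : is_submodule N ->
  is_submodule (image_sum cartier_op N : set M).
Proof.
move=> /is_submoduleP[_ NZ]; have [zm _ mulC span _] := cartier_graded C_cartier.
apply/is_submoduleP; split; first exact: gen_closed.
move=> c x; apply: (gen_preim (h := fun x : M => c *: x)).
- by split; [rewrite scaler0|move=> *; rewrite scalerDr].
- exact: gen_closed.
move=> _ [_ [m [[e [phi [e0 Cphi ->]]] Nm ->]]].
have [n [d [Cd ->]]] := span c; rewrite scaler_suml.
apply: add_closed_sum => [|i]; first exact: gen_closed.
apply: mem_gen; exists (fun m => (d i * phi) *: (m : M)), m.
split=> //; last by rewrite scalerA.
by exists (i + e)%N, (d i * phi); rewrite addn_gt0 e0 orbT; split=> //; apply: mulC.
Qed.

Lemma cartier_op_sub (N : set M) : is_submodule N -> image_sum cartier_op N `<=` N.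
Proof.
move=> /is_submoduleP[Na NZ]; apply: gen_min => //.
by move=> _ [_ [m [[e [c [_ _ ->]]] Nm ->]]]; apply: NZ.
Qed.

Lemma iter_cartier_op_submodule n :
  is_submodule (iter n (image_sum cartier_op) setT : set M).
Proof.
elim: n => [|n IH]; last exact: cartier_op_submodule.
by apply/is_submoduleP; split.
Qed.

Lemma irrelevant_part_homogeneous e c : (0 < e)%N -> Cg e c -> irrelevant_part Cg c.
Proof.
move=> e0 Cc; have [zm _ _ _ _] := cartier_graded C_cartier.
exists e.+1, (fun i => if i == e then c else 0); split=> [i|].
  case: eqP => [->//|_]; have [+ _] := zm i; by rewrite inE.
rewrite big_mkcond big_nat_recr //= eqxx big_nat big1 ?add0r // => i /andP[_ ie].
by rewrite ltn_eqF.
Qed.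

Lemma Cplus_power_iter n :
  Cplus_power Cg n = iter n (image_sum cartier_op) setT :> set M.
Proof.
have [zm _ mulC span _] := cartier_graded C_cartier.
have Ts := iter_cartier_op_submodule; apply/seteqP; split.
  apply: smallest_sub => //; move=> _ [phi [m [Cphi ->]]].
  elim: n phi Cphi => [|n IH] phi Cphi //; rewrite big_ord_recl -scalerA iterS.
  have [d [c [Cc ->]]] := Cphi ord0; rewrite scaler_suml big_nat_cond.
  apply: big_ind => [||i]; [exact: gen0|exact: gen_add|].
  move=> /andP[/andP[i0 _] _]; apply: mem_gen.
  exists (fun m => c i *: (m : M)), ((\prod_(i < n) phi (lift ord0 i)) *: m); split=> //.
    by exists i, (c i).
  exact: IH.
elim: n => [|n IH].
  move=> m _; apply: sub_gen_smallest; exists (fun=> 0), m; split; first by case.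
  by rewrite big_ord0 scale1r.
have Ps j : is_submodule (Cplus_power Cg j : set M).
  apply/is_submoduleP; split; first split.
  - by move=> N [/is_submoduleP[[]]].
  - by move=> x y Px Py N HN; have [/is_submoduleP[[_ ND] _] _] := HN;
      apply: ND; [apply: Px|apply: Py].
  by move=> c x Px N HN; have [/is_submoduleP[_ NZ] _] := HN; apply: NZ; apply: Px.
have /is_submoduleP[Pa PZ] := Ps n.+1.
apply: gen_min => // _ [_ [m [[e [phi [e0 Cphi ->]]] /IH Pm ->]]].
(* [N] quantifies over all homogeneous [phi] of positive degree because this makes it a
   [C]-submodule: [phi * c] splits into components of various positive degrees. *)
move: e phi e0 Cphi; pose N : set M := [set m | forall e phi, (0 < e)%N -> Cg e phi ->
  (Cplus_power Cg n.+1 : set M) (phi *: m)].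
suff : (Cplus_power Cg n : set M) `<=` N by apply.
apply: smallest_sub.
  apply/is_submoduleP; case: (Pa) => P0 PD; split; first split.
  - by move=> e phi _ _; rewrite scaler0.
  - by move=> x y Nx Ny e phi e0 Cphi; rewrite scalerDr; apply: PD;
      [apply: (Nx e)|apply: (Ny e)].
  move=> c x Nx e phi e0 Cphi; have [l [d [Cd ->]]] := span c.
  rewrite scalerA mulr_sumr scaler_suml; apply: (@add_closed_sum M _ _ _ _ Pa) => i.
  by apply: (Nx (e + i)%N); rewrite ?addn_gt0 ?e0 //; apply: mulC.
move=> _ [psi [x [Cpsi ->]]] e phi e0 Cphi; apply: sub_gen_smallest.
exists (fun i => if unlift ord0 i is Some j then psi j else phi), x; split.
  move=> i; case: unliftP => [j _|_]; first exact: Cpsi.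
  exact: irrelevant_part_homogeneous Cphi.
rewrite big_ord_recl unlift_none scalerA; congr (_ * _ *: _).
by apply: eq_bigr => i _; rewrite liftK.
Qed.

(** The class of m / 1 is also that of some m' / s with m' in [N]. Since it contains (m, 1), some u
    outside [eta] satisfies u s m = u m'. *)
Lemma agree_sle (Mc N : set M) (eta : Spec R) : is_submodule N ->
  localize iota N eta = localize iota Mc eta ->
  @sle R V [set s | ~ spec_ideal eta s] Mc N.
Proof.
move=> /is_submoduleP[_ NZ] E m Mm.
have eta1 := prime_proper (spec_prime eta).
have : localize iota Mc eta (fraction iota eta m 1) by exists m, 1.
rewrite -E => -[m' [s [Nm' etas Efr]]].
have : fraction iota eta m 1 (m, 1).
  by split=> //; exists 1; split=> //; rewrite subrr scaler0.
rewrite Efr => -[_ /= [u [etau]]]; rewrite rmorph1 scale1r scalerBr => /subr0_eq uE.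
exists (u * s); split; first by move=> /(prime_mul (spec_prime eta))[].
by rewrite restriction_scaleE rmorphM -scalerA -uE; apply: NZ.
Qed.

(** Expand fractions: m / t = (s m) / (s t). *)
Lemma localize_eq (Mc N : set M) (eta : Spec R) s : ~ spec_ideal eta s ->
  N `<=` Mc -> (forall m, Mc m -> N (iota s *: m)) ->
  localize iota N eta = localize iota Mc eta.
Proof.
move=> etas NMc sMc; apply/seteqP; split=> _ [m [t [Nm etat ->]]].
  by exists m, t; split=> //; apply: NMc.
have etaM a b : ~ spec_ideal eta a -> ~ spec_ideal eta b -> ~ spec_ideal eta (a * b).
  by move=> na nb /(prime_mul (spec_prime eta))[].
exists (iota s *: m), (s * t); split; [exact: sMc|exact: etaM|].
have comm a b (x : M) : iota a *: (iota b *: x) = iota b *: (iota a *: x).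
  by rewrite !scalerA -!rmorphM mulrC.
apply/seteqP; split=> -[x r] [/= etar [u [etau Hu]]]; split=> //=.
  exists u; split=> //; rewrite rmorphM -scalerA [iota r *: _]comm -scalerBr comm Hu.
  by rewrite scaler0.
exists (u * s); split; first exact: etaM.
move: Hu; rewrite rmorphM -scalerA [iota r *: _]comm -scalerBr => Hu.
by rewrite rmorphM -scalerA.
Qed.

End CartierModule.

(** * Construction of the test module *)

Theorem theorem4p13 (p : nat) (k : fieldType) (pchar_k : p \in [pchar k])
  (k_F_finite : F_finite p k)
  (R : comPzRingType) (f : {rmorphism k -> R}) (R_ft : of_finite_type f)
  (C : pzRingType) (iota : {rmorphism R -> C}) (Cg : nat -> set C)
  (C_cartier : is_cartier_algebra p iota Cg)
  (M : lmodType C) (M_coherent : coherent iota M) :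
  exists tau : set M, is_test_module iota Cg tau.
Proof.
have Rn := finite_type_noeth R_ft; have Rr := subring_setT R.
have [n [x Rx]] := R_ft; have [m [g gP]] := M_coherent.
pose V : lmodType R := restriction iota M; pose gs : seq V := codom g.
have Vgs : lspan_seq setT gs = setT.
  apply/seteqP; split=> // v _; have [r ->] := gP v.
  apply: (@add_closed_sum V _ _ _ _ (gen_closed _)) => i; apply: mem_gen.
  by exists (r i), (g i); split=> //; apply: codom_f.
have p_gt1 := prime_gt1 (pcharf_prime pchar_k).
pose Op := @cartier_op R C iota Cg M; have Opl := cartier_op_plinear C_cartier (M := M).
have [n0 Tn0] := stable_image_sum p_gt1 Rn Vgs Opl.
pose Mc : set M := iter n0 (image_sum Op) setT.
have Mc_sub : is_submodule Mc by exact: (iter_cartier_op_submodule C_cartier).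
have Mcs : @submod R V setT Mc by apply: submodule_restriction.
have Mc_pure : image_sum Op Mc = Mc by rewrite -[LHS]iterS Tn0.
have Mc_fg : @fin_gen R V setT Mc.
  by apply: (noeth_module Rr Rn (gs := gs)) => //; rewrite Vgs.
have agree_Mc : agrees_generically iota Mc Mc by [].
(* Minimality of this intersection is immediate; the content is that it still agrees with [Mc] at
   the generic points. *)
exists [set v | forall N, is_submodule N -> agrees_generically iota Mc N -> N v], Mc.
split.
- by exists n0 => j nj; rewrite (Cplus_power_iter C_cartier) Tn0.
- split.
    apply/is_submoduleP; split; first split.
    + by move=> N /is_submoduleP[[]].
    + move=> u v Hu Hv N Ns aN; case/is_submoduleP: (Ns) => -[_ ND] _.
      by apply: ND; [apply: Hu|apply: Hv].
    by move=> c v Hv N Ns aN; case/is_submoduleP: (Ns) => _ NZ; apply: NZ; apply: Hv.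
  move=> Z eta Zcomp Zeta; pose S := [set s | ~ spec_ideal eta s].
  have S1 : S 1 := prime_proper (spec_prime eta).
  have SM s t : S s -> S t -> S (s * t) by move=> ns nt /(prime_mul (spec_prime eta))[].
  have [G [[s [Ss sG]] Gmin]] :=
    least_compatible pchar_k k_F_finite Rx Vgs Rn Opl S1 SM Mcs Mc_pure.
  (* [Mc] itself is among the intersected submodules, which gives one inclusion. For the other,
     agreement of [N] at [eta] provides a common denominator carrying [Mc] into [N], so [G] and
     hence s Mc lie in every such [N], with [s] independent of [N]. *)
  apply: (localize_eq Ss); first by move=> v; apply.
  move=> v Mv N Ns aN; apply: (Gmin N); last exact: sG.
  + exact: submodule_restriction.
  + exact: cartier_op_sub.
  have Nrs := @submodule_restriction R C iota M N Ns.
  exact: sle_fin_gen S1 SM Nrs Mc_fg (agree_sle Ns (aN _ _ Zcomp Zeta)).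
by move=> N' N's aN' v; apply.
Qed.
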